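(* The classical Fenchel–Nielsen construction is a $zw=t$ plumbing construction for a parameter $t$ of modulus $e^{-\pi^2/\lambda}$. That is, for every $\lambda>0$ and $\tau\in\mathbb{R}$, the punctured torus $\mathbb{H}^2/G(\lambda,\tau)$ obtained by gluing the two boundary geodesics of the punctured cylinder by means of $T$ is obtained from $X_0$ by the $zw=t$ plumbing construction for some $t\in\mathbb{C}$ with $|t|=e^{-\pi^2/\lambda}$.
   Context: For $\lambda>0$, $\tau\in\mathbb{R}$ put $$S=\begin{pmatrix}\cosh\lambda&\cosh\lambda+1\\ \cosh\lambda-1&\cosh\lambda\end{pmatrix},\quad S'=\begin{pmatrix}\cosh\lambda&\cosh\lambda-1\\ \cosh\lambda+1&\cosh\lambda\end{pmatrix},\quad T=\begin{pmatrix}\cosh(\tau/2)\coth(\lambda/2)&-\sinh(\tau/2)\\-\sinh(\tau/2)&\cosh(\tau/2)\tanh(\lambda/2)\end{pmatrix},$$ so $T^{-1}ST=S'$. Let $G_0=\langle S,S'\rangle$, a Fuchsian group of the second kind acting on the upper half plane $\mathbb{H}^2$. The surface $X_0=\mathbb{H}^2/G_0$ is a sphere with one puncture and two infinite area ends, with ideal boundary components $b_1,b_2$ and corresponding boundary geodesics $\gamma_1$ (image of $\operatorname{axis}S$) and $\gamma_2$ (image of $\operatorname{axis}S'$), both of length $2\lambda$; its convex core is a punctured cylinder bounded by $\gamma_1,\gamma_2$. The classical Fenchel–Nielsen construction glues $\gamma_1$ to $\gamma_2$ by adjoining $T$ to $G_0$, giving the Fuchsian group $G(\lambda,\tau)=\langle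 G_0,T\rangle=\langle S,T\rangle$ and the punctured torus $\mathbb{H}^2/G(\lambda,\tau)$. Plumbing. Let $\gamma_{12}$ be the shortest geodesic arc joining $\gamma_1$ and $\gamma_2$, let $\mathcal{A}_\lambda=\{\zeta\in\mathbb{C}:e^{-\pi^2/\lambda}<|\zeta|<1\}$ with its hyperbolic metric of curvature $-1$, and let $U_1,U_2$ be neighbourhoods of the ends of $X_0$ corresponding to $\gamma_1,\gamma_2$. Local coordinates $z:U_1\to\mathcal{A}_\lambda$, $w:U_2\to\mathcal{A}_\lambda$ are defined by requiring that they are isometries (onto their images) and that $\gamma_{12}\cap U_1$, $\gamma_{12}\cap U_2$ are mapped into $\mathcal{A}_\lambda\cap\mathbb{R}_+$; in terms of a lift $\zeta\in\mathbb{H}^2$ they are $$z=\exp\left(\frac{\pi i}{\lambda}\log\frac{\zeta\sinh(\lambda/2)+\cosh(\lambda/2)}{-\zeta\sinh(\lambda/2)+\cosh(\lambda/2)}\right),\qquad w=\exp\left(\frac{\pi i}{\lambda}\log\frac{\zeta\cosh(\lambda/2)-\sinh(\lambda/2)}{\zeta\cosh(\lambda/2)+\sinh(\lambda/2)}\right).$$ For an annulus $A\subset X_0$ homotopic to a boundary component $b$, the outer boundary of $A$ is the component of $\partial A$ separating the other component of $\partial A$ from $b$; the other component of $\partial A$ is the inner boundary. Suppose there are annuli $A_i\subset U_i$ and a holomorphic homeomorphism $f:A_1\to A_2$ mapping the outer boundary of $A_1$ to the inner boundary of $A_2$ with $z(x)w(f(x))=t$ for a constant $t\in\mathbb{C}$.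 The outer boundaries bound annuli on $X_0$ (the ends beyond them); remove these to form $X_{\mathrm{trunc}}$ and set $X_t=X_{\mathrm{trunc}}/\sim$, where $x\sim y$ if and only if $z(x)w(y)=t$. Then $X_t$ is said to be obtained from $X_0$ by the $zw=t$ plumbing construction with plumbing parameter $t$. *)

(* Defs.v *)
From HB Require Import structures.
From mathcomp Require Import all_boot all_order all_algebra.
From mathcomp Require Import all_classical all_reals all_analysis.
From mathcomp Require Import complex.
From Stdlib Require Import Relation_Operators.

Set Implicit Arguments.
Unset Strict Implicit.
Unset Printing Implicit Defensive.

Import Order.TTheory GRing.Theory Num.Theory.
Import numFieldNormedType.Exports.

Local Open Scope classical_set_scope.
Local Open Scope quotient_scope.
Local Open Scope ring_scope.
Local Open Scope complex_scope.

(* The library puts the normed topology on R[i]^o only. *)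
HB.instance Definition _ (R : realType) := NormedModule.copy R[i] R[i]^o.

Section elementary_functions.
Context {R : realType}.

Definition cosh (x : R) : R := (expR x + expR (- x)) / 2.
Definition sinh (x : R) : R := (expR x - expR (- x)) / 2.
Definition tanh (x : R) : R := sinh x / cosh x.
Definition coth (x : R) : R := cosh x / sinh x.

Definition cabs (z : R[i]) : R := complex.Re `|z|.

Definition cexp (z : R[i]) : R[i] :=
  (expR (complex.Re z))%:C * (cos (complex.Im z) +i* sin (complex.Im z)).

(* Principal branch, with argument in ]-pi, pi]. *)
Definition carg (z : R[i]) : R :=
  if 0 <= complex.Im z then acos (complex.Re z / cabs z)
  else - acos (complex.Re z / cabs z).
Definition clog (z : R[i]) : R[i] := ln (cabs z) +i* carg z.

End elementary_functions.

(* A Riemann surface is given by its topological space and its structure sheaf: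
   [holo U g] means that [U] is open and that [g] is holomorphic on [U] (the
   values of [g] outside [U] being irrelevant). *)
Record surface (R : realType) := Surface {
  carrier :> topologicalType ;
  holo : set carrier -> (carrier -> R[i]) -> Prop }.

Section surfaces.
Context {R : realType}.

Definition complex_plane : surface R :=
  @Surface R R[i] (fun U g => open U /\ forall z, U z -> derivable g z 1).

(* If [A] is not open, then it is treated as a bordered surface: functions are
   required to be continuous up to the border and holomorphic inside. *)
Definition subsurface (X : surface R) (A : set X) : surface R :=
  @Surface R (set_type A) (fun U g =>
    [/\ open U, {within U, continuous g} &
      exists2 G : X -> R[i], holo ((set_val @` U) `&` A°) G &
        forall u, U u -> A° (set_val u) -> G (set_val u) = g u]).

Definition quotient_surface (X : surface R) (e : equiv_rel X) : surface R :=
  @Surface R (quotient_topology {eq_quot e}) (fun U g =>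
    holo ((\pi_{eq_quot e} : X -> quotient_topology {eq_quot e}) @^-1` U)
         (g \o (\pi_{eq_quot e} : X -> quotient_topology {eq_quot e}))).

Definition holomorphic_on (X Y : surface R) (A : set X) (f : X -> Y) : Prop :=
  {within A, continuous f} /\
  forall (V : set Y) (g : Y -> R[i]),
    holo V g -> holo (A `&` f @^-1` V) (g \o f).

Definition biholomorphic (X Y : surface R) : Prop :=
  exists (f : X -> Y) (g : Y -> X),
    [/\ cancel f g, cancel g f, holomorphic_on setT f & holomorphic_on setT g].

End surfaces.

Section topology.
Context {R : realType}.

Definition homeomorphism_on (X Y : topologicalType) (A : set X) (B : set Y)
    (f : X -> Y) : Prop :=
  exists g : Y -> X,
    [/\ f @` A `<=` B, g @` B `<=` A,
        forall x, A x -> g (f x) = x, forall y, B y -> f (g y) = y &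
        {within A, continuous f} /\ {within B, continuous g}].

Definition boundary (X : topologicalType) (A : set X) : set X :=
  closure A `\` A°.

Definition is_component (X : topologicalType) (A K : set X) : Prop :=
  exists2 x, A x & K = connected_component A x.

Definition freely_homotopic (X : topologicalType) (c0 c1 : R -> X) : Prop :=
  exists H : R * R -> X,
    [/\ {within (`[0, 1]%classic : set R) `*` (`[0, 1]%classic : set R),
          continuous H},
        forall s, s \in `[0, 1] -> H (0, s) = c0 s,
        forall s, s \in `[0, 1] -> H (1, s) = c1 s &
        forall u, u \in `[0, 1] -> H (u, 0) = H (u, 1)].

Definition round_annulus (r r' : R) : set R[i] :=
  [set z | r < cabs z < r'].

(* exp (2 pi i s) *)
Definition unit_circle (s : R) : R[i] := cexp (0 +i* (2 * pi * s)).

End topology.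

Section fuchsian.
Context {R : realType}.

Definition matrix2 (a b c d : R) : 'M[R]_2 :=
  \matrix_(i < 2, j < 2)
    if i == 0 then (if j == 0 then a else b) else (if j == 0 then c else d).

Definition matS (lambda : R) : 'M[R]_2 :=
  matrix2 (cosh lambda) (cosh lambda + 1) (cosh lambda - 1) (cosh lambda).

Definition matS' (lambda : R) : 'M[R]_2 :=
  matrix2 (cosh lambda) (cosh lambda - 1) (cosh lambda + 1) (cosh lambda).

Definition matT (lambda tau : R) : 'M[R]_2 :=
  matrix2 (cosh (tau / 2) * coth (lambda / 2)) (- sinh (tau / 2))
          (- sinh (tau / 2)) (cosh (tau / 2) * tanh (lambda / 2)).

Definition matrix_group (G : set 'M[R]_2) : Prop :=
  [/\ G 1, forall g h, G g -> G h -> G (g * h) & forall g, G g -> G g^-1].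

Definition group_generated (A : set 'M[R]_2) : set 'M[R]_2 :=
  smallest matrix_group A.

Definition mobius (g : 'M[R]_2) (z : R[i]) : R[i] :=
  ((g 0 0)%:C * z + (g 0 1)%:C) / ((g 1 0)%:C * z + (g 1 1)%:C).

Definition half_plane : surface R :=
  @subsurface R complex_plane [set z : R[i] | 0 < complex.Im z].

(* The inclusion of the upper half plane in the complex plane. *)
Definition hval (x : half_plane) : R[i] := set_val x.

Definition orbit (G : set 'M[R]_2) (x : half_plane) : set half_plane :=
  [set y | exists2 g, G g & hval y = mobius g (hval x)].

Definition same_orbit (G : set 'M[R]_2) : rel half_plane :=
  fun x y => `[< orbit G x = orbit G y >].

Lemma same_orbit_refl G : reflexive (same_orbit G).
Proof. by move=> x; exact/asboolP. Qed.

Lemma same_orbit_sym G : symmetric (same_orbit G).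
Proof. by move=> x y; apply/asboolP/asboolP. Qed.

Lemma same_orbit_trans G : transitive (same_orbit G).
Proof. by move=> y x z /asboolP xy /asboolP yz; apply/asboolP; rewrite xy. Qed.

Canonical same_orbit_equiv G :=
  EquivRel (same_orbit G)
    (same_orbit_refl G) (same_orbit_sym G) (@same_orbit_trans G).

Definition orbit_surface (G : set 'M[R]_2) : surface R :=
  quotient_surface (same_orbit_equiv G).

Definition groupG0 (lambda : R) : set 'M[R]_2 :=
  group_generated [set matS lambda; matS' lambda].

Definition groupG (lambda tau : R) : set 'M[R]_2 :=
  group_generated (groupG0 lambda `|` [set matT lambda tau]).

Definition surfaceX0 (lambda : R) : surface R := orbit_surface (groupG0 lambda).

Definition punctured_torus (lambda tau : R) : surface R :=
  orbit_surface (groupG lambda tau).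

Definition projX0 (lambda : R) (x : half_plane) : surfaceX0 lambda :=
  \pi_{eq_quot (same_orbit_equiv (groupG0 lambda))} x.

End fuchsian.

Section plumbing.
Context {R : realType}.

Definition critical_modulus (lambda : R) : R := expR (- (pi ^+ 2 / lambda)).

(* The local coordinates z and w lifted to the upper half plane. Each is the
   composition of a Moebius automorphism of the half plane with the universal
   covering exp (pi i / lambda * log) of the annulus
   [round_annulus (critical_modulus lambda) 1], hence is a local isometry for
   the hyperbolic metrics; both are positive on the imaginary axis, which
   contains a lift of the common perpendicular of the boundary geodesics. *)
Definition zlift (lambda : R) (x : half_plane) : R[i] :=
  let c := (cosh (lambda / 2))%:C in let s := (sinh (lambda / 2))%:C in
  cexp ((0 +i* (pi / lambda)) *
        clog ((hval x * s + c) / (- hval x * s + c))).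

Definition wlift (lambda : R) (x : half_plane) : R[i] :=
  let c := (cosh (lambda / 2))%:C in let s := (sinh (lambda / 2))%:C in
  cexp ((0 +i* (pi / lambda)) *
        clog ((hval x * c - s) / (hval x * c + s))).

(* In what follows, [lift] stands for [zlift lambda] or [wlift lambda] and
   thereby designates an end of X_0: the ideal boundary component lies over
   the circle [|lift| = critical_modulus lambda]. *)

Definition lifted_collar (lift : half_plane -> R[i]) (r : R) :
  set (half_plane (R := R)) := [set x | cabs (lift x) < r].

Definition end_neighborhood (lambda : R) (lift : half_plane -> R[i])
    (B : set (surfaceX0 lambda)) : Prop :=
  exists2 r, critical_modulus lambda < r &
    projX0 lambda @` lifted_collar lift r `<=` B.

(* [z] is the local coordinate, given by [lift], on the neighborhood
   [projX0 lambda @` V] of the end. As [lift] is a local isometry, [z] is an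
   isometry onto its image as soon as it is injective. *)
Record end_coordinate (lambda : R) (lift : half_plane -> R[i])
    (V : set half_plane) (z : surfaceX0 lambda -> R[i]) : Prop := {
  coord_open : open V ;
  coord_connected : connected V ;
  coord_collar : exists2 r, critical_modulus lambda < r &
    lifted_collar lift r `<=` V ;
  coord_lift : forall x, V x -> z (projX0 lambda x) = lift x ;
  coord_range : z @` (projX0 lambda @` V) `<=`
    round_annulus (critical_modulus lambda) 1 ;
  coord_inj : forall p q, (projX0 lambda @` V) p -> (projX0 lambda @` V) q ->
    z p = z q -> p = q }.

(* The core curve of [A] is freely homotopic to a curve going once around the
   end along a circle [|lift| = r]. *)
Definition homotopic_to_end (lambda : R) (lift : half_plane -> R[i])
    (A : set (surfaceX0 lambda)) : Prop :=
  exists h : R[i] -> surfaceX0 lambda,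
    homeomorphism_on (round_annulus 1 2) A h /\
    exists (c : R -> half_plane) (r : R),
      [/\ {within `[0, 1]%classic, continuous c},
          forall s, s \in `[0, 1] -> lift (c s) = r%:C * unit_circle s &
          freely_homotopic (fun s => h ((3 / 2)%:C * unit_circle s))
                           (projX0 lambda \o c)].

(* [A] is an annulus homotopic to the boundary component of the end, with
   outer boundary [O] and inner boundary [I]; [E] is the part of the surface
   beyond [O], and [O] separates [I] from the end because [E] does not
   meet [I]. *)
Record end_annulus (lambda : R) (lift : half_plane -> R[i])
    (A O I E : set (surfaceX0 lambda)) : Prop := {
  annulus_open : open A ;
  annulus_homotopic : homotopic_to_end lift A ;
  annulus_outer : is_component (boundary A) O ;
  annulus_inner : is_component (boundary A) I ;
  annulus_neq : O <> I ;
  annulus_boundary : boundary A = O `|` I ;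
  annulus_beyond : is_component (~` O) E ;
  annulus_end : end_neighborhood lift E ;
  annulus_separates : E `&` I = set0 }.

Record plumbing (lambda : R) (t : R[i]) := Plumbing {
  lift1 : set (half_plane (R := R)) ;
  lift2 : set (half_plane (R := R)) ;
  U1 : set (surfaceX0 lambda) := projX0 lambda @` lift1 ;
  U2 : set (surfaceX0 lambda) := projX0 lambda @` lift2 ;
  z1 : surfaceX0 lambda -> R[i] ;
  w2 : surfaceX0 lambda -> R[i] ;
  z1_coordinate : end_coordinate (zlift lambda) lift1 z1 ;
  w2_coordinate : end_coordinate (wlift lambda) lift2 w2 ;
  U_disjoint : U1 `&` U2 = set0 ;
  A1 : set (surfaceX0 lambda) ;
  outer1 : set (surfaceX0 lambda) ;
  inner1 : set (surfaceX0 lambda) ;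
  beyond1 : set (surfaceX0 lambda) ;
  A2 : set (surfaceX0 lambda) ;
  outer2 : set (surfaceX0 lambda) ;
  inner2 : set (surfaceX0 lambda) ;
  beyond2 : set (surfaceX0 lambda) ;
  A1_annulus : end_annulus (zlift lambda) A1 outer1 inner1 beyond1 ;
  A2_annulus : end_annulus (wlift lambda) A2 outer2 inner2 beyond2 ;
  A1_sub : A1 `<=` U1 ;
  A2_sub : A2 `<=` U2 ;
  attaching : surfaceX0 lambda -> surfaceX0 lambda ;
  attaching_homeo : homeomorphism_on A1 A2 attaching ;
  attaching_holo : holomorphic_on A1 attaching ;
  attaching_closure : {within closure A1, continuous attaching} ;
  attaching_boundary : attaching @` outer1 = inner2 ;
  attaching_zw : forall x, A1 x -> z1 x * w2 (attaching x) = t }.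

Section plumbed_surface.
Context (lambda : R) (t : R[i]) (P : plumbing lambda t).

Definition truncated_surface : surface R :=
  @subsurface R (surfaceX0 lambda) (~` (beyond1 P `|` beyond2 P)).

Definition identified (x y : truncated_surface) : Prop :=
  [/\ U1 P (set_val x), U2 P (set_val y) &
      z1 P (set_val x) * w2 P (set_val y) = t].

Definition glued : rel truncated_surface :=
  fun x y => `[< clos_refl_sym_trans _ identified x y >].

Lemma glued_refl : reflexive glued.
Proof. by move=> x; apply/asboolP; exact: rst_refl. Qed.

Lemma glued_sym : symmetric glued.
Proof. by move=> x y; apply/asboolP/asboolP; exact: rst_sym. Qed.

Lemma glued_trans : transitive glued.
Proof.
move=> y x z /asboolP xy /asboolP yz; apply/asboolP; exact: rst_trans xy yz.
Qed.

Canonical glued_equiv := EquivRel glued glued_refl glued_sym glued_trans.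

Definition plumbed_surface : surface R := quotient_surface glued_equiv.

End plumbed_surface.

End plumbing.

(* Main.v *)
Require Import Defs.
From mathcomp Require Import all_boot all_order all_algebra.
From mathcomp Require Import all_classical all_reals all_analysis.
From mathcomp Require Import complex.
From mathcomp Require Import ring lra.
From Stdlib Require Import Relation_Operators.
Set Implicit Arguments.
Unset Strict Implicit.
Unset Printing Implicit Defensive.
Import Order.TTheory GRing.Theory Num.Theory.
Import numFieldNormedType.Exports.
Local Open Scope classical_set_scope.
Local Open Scope ring_scope.
Local Open Scope quotient_scope.
Local Open Scope complex_scope.

(** Write [u] and [v] for the images of a point of the half plane under the
    Moebius maps inside [zlift] and [wlift]. They place the axes of [S] and [S']
    on the imaginary axis, where [S] and [S'^-1] become multiplication by
    [expR (2 * la)], and in these terms [T] is [v |-> u = - expR (- tau) / v]. So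
    [T] turns the argument [a] of [v] into [pi - a]. As
    [exp ((pi i / la) log u)] has modulus [expR (- (pi / la) * arg u)], the
    product of the coordinates of [T x] and [x] is the constant
    [t = expR (- (pi ^+ 2 / la)) * exp (- i pi tau / la)] ([zw_T]). Thus glueing by
    [T] is glueing by [z * w = t]; the annuli are thin collars around the two
    boundary geodesics [arg = pi / 2], and the attaching map is [T^-1].

    It remains to see that the collars are embedded and disjoint in [X0], and
    that the plumbed surface is the whole torus, each point once.

    The group [groupG0] is a Schottky-like free group: [S] and [S'^-1] play
    ping-pong with four disjoint half planes, some of which touch at ideal points
    (hence the puncture). The collars [ctn < collar_width], where [ctn] is the
    cotangent of the argument of [u] or [v], avoid the half planes of the other
    generator; so each of them is precisely invariant under the cyclic group of
    its axis and disjoint from the translates of the other one ([collar_precise], [collars_apart]).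

    Let the core be the part of the half plane that is not beyond any lift of a
    boundary geodesic. A second ping-pong, for the HNN extension of [groupG0] by
    [T], shows that points of the core that are equivalent under [groupG] are
    equivalent under [groupG0] ([core_precise]). Conversely every orbit meets the
    core ([core_cover]): by [sector_gap] a point at hyperbolic distance less than
    a fixed bound from the core is in the core or has just crossed a boundary
    geodesic into a collar, whence [T] or its inverse brings it back; the
    translates of the core are therefore open and closed in the half plane.

    Since the core maps to the interior of the truncated surface and each point
    of the truncated surface is glued to a point of the core, the identity of the
    half plane induces mutually inverse holomorphic maps between the plumbed
    surface and the torus. *)
(** * Topology of the complex plane and of the half plane *)

Section ComplexTopology.
Context {R : realType}.
Implicit Types (z w : R[i]) (a b e : R).

Lemma norm_complexE z : `|z| = (Num.sqrt (complex.Re z ^+ 2 + complex.Im z ^+ 2))%:C.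
Proof. exact: normc_def. Qed.

(** Squares are comparable to the disks of the norm of [R[i]], whose radii are
    themselves complex numbers; all further estimates are then real ones. *)
Lemma nbhs_complexP z (U : set R[i]) :
  nbhs z U <-> exists2 e : R, 0 < e & forall w,
    `|complex.Re w - complex.Re z| < e -> `|complex.Im w - complex.Im z| < e -> U w.
Proof.
split.
  move=> /nbhs_normP [e /= e0 zU].
  have [ei er] : complex.Im e = 0 /\ 0 < complex.Re e.
    by move: e0; rewrite ltcE /= => /andP[/eqP -> ->].
  exists (complex.Re e / 2); first by rewrite divr_gt0.
  move=> w rw iw; apply: zU; rewrite /ball_ /=.
  have -> : e = (complex.Re e)%:C by case: e ei {e0 er rw iw} => x y /= ->.
  rewrite norm_complexE ltcR.
  rewrite -(ltr_pXn2r (n := 2)) ?nnegrE ?sqrtr_ge0 ?ltW// sqr_sqrtr; last first.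
    by rewrite addr_ge0 ?sqr_ge0.
  have -> : complex.Re (z - w) = complex.Re z - complex.Re w by case: (z) (w) => ? ? [].
  have -> : complex.Im (z - w) = complex.Im z - complex.Im w by case: (z) (w) => ? ? [].
  move: rw iw; rewrite !(distrC _ (complex.Re z)) !(distrC _ (complex.Im z)).
  rewrite !ltr_norml => /andP[? ?] /andP[? ?]; nra.
move=> [e e0 zU]; apply/nbhs_normP; exists e%:C; rewrite /= ?ltcR// => w.
rewrite /ball_ /= norm_complexE ltcR.
have -> : complex.Re (z - w) = complex.Re z - complex.Re w by case: (z) (w) => ? ? [].
have -> : complex.Im (z - w) = complex.Im z - complex.Im w by case: (z) (w) => ? ? [].
move=> zw.
have lt (x y : R) : Num.sqrt (x ^+ 2 + y ^+ 2) < e -> `|x| < e.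
  by move=> xy; apply: le_lt_trans xy; rewrite -sqrtr_sqr ler_wsqrtr// lerDl sqr_ge0.
by apply: zU; rewrite distrC; [apply: (lt _ _ zw) | rewrite addrC in zw; apply: (lt _ _ zw)].
Qed.

Lemma continuous_dist (T : topologicalType) (f : T -> R) (x : T) e :
  {for x, continuous f} -> 0 < e -> nbhs x [set t | `|f t - f x| < e].
Proof.
move=> cf e0; have nx : nbhs x (f @^-1` ball (f x) e) by exact/cf/nbhsx_ballx.
by apply: filterS nx => t; rewrite /preimage /ball /= distrC.
Qed.

Lemma continuous_Re : continuous (@complex.Re R : R[i] -> R).
Proof.
move=> z U /nbhs_ballP [e /= e0 zU]; apply/nbhs_complexP; exists e => // w rw _.
by apply: zU; rewrite /ball /= distrC.
Qed.

Lemma continuous_Im : continuous (@complex.Im R : R[i] -> R).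
Proof.
move=> z U /nbhs_ballP [e /= e0 zU]; apply/nbhs_complexP; exists e => // w _ rw.
by apply: zU; rewrite /ball /= distrC.
Qed.

Lemma continuous_complex (T : topologicalType) (f g : T -> R) x :
  {for x, continuous f} -> {for x, continuous g} ->
  {for x, continuous (fun t => f t +i* g t : R[i])}.
Proof.
move=> cf cg U /nbhs_complexP [e e0 xU].
have crossing : nbhs x [set t | `|f t - f x| < e].
  exact: continuous_dist cf e0.
have ng : nbhs x [set t | `|g t - g x| < e].
  exact: continuous_dist cg e0.
by apply: filterS (filterI crossing ng) => t [ft gt]; exact: xU.
Qed.

Lemma open_upper_half_plane : open [set z : R[i] | 0 < complex.Im z].
Proof.
have -> : [set z : R[i] | 0 < complex.Im z] = @complex.Im R @^-1` `]0, +oo[%classic.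
  by apply/seteqP; split => z /=; rewrite in_itv /= andbT.
by apply: open_comp => [z _|]; [exact: continuous_Im | exact: interval_open].
Qed.

End ComplexTopology.

Section RealContinuity.
Context {R : realType} {T : topologicalType} (f g : T -> R) (t : T).
Hypotheses (cf : {for t, continuous f}) (cg : {for t, continuous g}).

Lemma contD : {for t, continuous (fun x => f x + g x)}.
Proof. exact: cvgD cf cg. Qed.

Lemma contB : {for t, continuous (fun x => f x - g x)}.
Proof. exact: cvgB cf cg. Qed.

Lemma contM : {for t, continuous (fun x => f x * g x)}.
Proof. exact: cvgM cf cg. Qed.

Lemma contV : f t != 0 -> {for t, continuous (fun x => (f x)^-1)}.
Proof. by move=> f0; exact: cvgV f0 cf. Qed.

Lemma contcst (a : R) : {for t, continuous (fun _ : T => a)}.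
Proof. exact: cvg_cst. Qed.

End RealContinuity.

Lemma contcomp {R : realType} {T : topologicalType} (h : R -> R) (f : T -> R) (t : T) :
  {for t, continuous f} -> {for f t, continuous h} ->
  {for t, continuous (fun x => h (f x))}.
Proof. by move=> cf ch; apply: continuous_comp. Qed.

Section HalfPlane.
Context {R : realType}.
Local Notation H := (half_plane (R := R)).
Implicit Types (x y : H) (g h : 'M[R]_2).

Definition hre x : R := complex.Re (hval x).
Definition him x : R := complex.Im (hval x).

Lemma him_gt0 x : 0 < him x.
Proof. by have := set_valP x. Qed.

Lemma hvalE x : hval x = hre x +i* him x.
Proof. by rewrite /hre /him; case: (hval x). Qed.

Lemma hval_inj : injective (@hval R).
Proof. exact: val_inj. Qed.

Lemma half_plane_eq x y : hre x = hre y -> him x = him y -> x = y.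
Proof. by move=> r i; apply: hval_inj; rewrite !hvalE r i. Qed.

(* The point [i]. *)
Definition hi : H := SigSub (mem_set (ltr01 : [set z : R[i] | 0 < complex.Im z] (0 +i* 1))).

Definition hof (z : R[i]) : H := insubd hi z.

Lemma hofK z : 0 < complex.Im z -> hval (hof z) = z.
Proof. by move=> z0; rewrite /hval /hof set_valE insubdK//; exact: mem_set. Qed.

Lemma hvalK : cancel (@hval R) hof.
Proof. by move=> x; apply: hval_inj; rewrite hofK//; exact: him_gt0. Qed.

Definition hpt (p y : R) : H := hof (p +i* y).

Lemma hre_pt (p y : R) : 0 < y -> hre (hpt p y) = p.
Proof. by move=> y0; rewrite /hre hofK. Qed.

Lemma him_pt (p y : R) : 0 < y -> him (hpt p y) = y.
Proof. by move=> y0; rewrite /him hofK. Qed.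

Lemma continuous_hval : continuous (@hval R : H -> R[i]).
Proof. exact: initial_continuous. Qed.

Lemma continuous_hre : continuous (hre : H -> R).
Proof. by move=> x; apply: continuous_comp; [exact: continuous_hval|exact: continuous_Re]. Qed.

Lemma continuous_him : continuous (him : H -> R).
Proof. by move=> x; apply: continuous_comp; [exact: continuous_hval|exact: continuous_Im]. Qed.

Lemma continuous_into_half_plane (T : topologicalType) (f : T -> H) t :
  {for t, continuous (@hval R \o f)} -> {for t, continuous f}.
Proof.
move=> cf U; rewrite nbhsE /= => -[_ [[A oA <-] fA]] AU.
have n : nbhs t ((@hval R \o f) @^-1` A) := cf A (open_nbhs_nbhs (conj oA fA)).
by change (nbhs t (f @^-1` U)); apply: filterS n => s; exact: AU.
Qed.

Lemma continuous_pt (T : topologicalType) (f g : T -> R) t :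
  (forall t, 0 < g t) -> {for t, continuous f} -> {for t, continuous g} ->
  {for t, continuous (fun t => hpt (f t) (g t))}.
Proof.
move=> g0 cf cg; apply: continuous_into_half_plane.
have -> : @hval R \o (fun t => hpt (f t) (g t)) = (fun t => f t +i* g t).
  by apply: funext => s /=; apply: hofK => /=.
exact: continuous_complex.
Qed.

Lemma open_hval (U : set H) : open U -> open (@hval R @` U).
Proof.
move=> [A oA <-]; rewrite (_ : _ @` _ = A `&` [set z | 0 < complex.Im z]).
  exact: openI oA open_upper_half_plane.
apply/seteqP; split => [_ [x Ax <-]|z [Az z0]]; first by split=> //; exact: him_gt0.
by exists (hof z); [change (A (hval (hof z))); rewrite hofK | exact: hofK].
Qed.

Lemma nbhs_hval x (U : set H) : nbhs x U -> nbhs (hval x) (@hof @^-1` U).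
Proof.
rewrite nbhsE => -[A [oA Ax] AU]; apply: filterS (open_nbhs_nbhs (conj (open_hval oA) _)).
  by move=> _ [y Ay <-]; rewrite /preimage /= hvalK; exact: AU.
by exists x.
Qed.

End HalfPlane.

(** * The action of real matrices on the half plane *)

Section Moebius.
Context {R : realType}.
Local Notation H := (half_plane (R := R)).
Implicit Types (x y : H) (g h : 'M[R]_2).

Lemma det2E g : \det g = g 0 0 * g 1 1 - g 0 1 * g 1 0.
Proof.
rewrite (expand_det_row g 0) !big_ord_recl big_ord0 /cofactor !det_mx11 !mxE /=.
rewrite (_ : lift 0 0 = 1); last exact: val_inj.
rewrite (_ : lift 1 0 = 0); last exact: val_inj.
by rewrite /bump /= expr0 expr1; ring.
Qed.

Lemma mul2E g h (i j : 'I_2) : (g * h) i j = g i 0 * h 0 j + g i 1 * h 1 j.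
Proof.
rewrite !mxE !big_ord_recl big_ord0 addr0.
by rewrite (_ : lift 0 0 = 1); last exact: val_inj.
Qed.

Lemma matrix2_eq g h : g 0 0 = h 0 0 -> g 0 1 = h 0 1 -> g 1 0 = h 1 0 ->
  g 1 1 = h 1 1 -> g = h.
Proof.
move=> e1 e2 e3 e4; apply/matrixP => i j.
have ord2 (k : 'I_2) : k = 0 \/ k = 1.
  by case: k => -[|[|//]] ?; [left|right]; exact: val_inj.
by case: (ord2 i) => ->; case: (ord2 j) => ->.
Qed.

Lemma complex_divE (a b c d : R) : (a +i* b) / (c +i* d) =
  ((a * c + b * d) / (c ^+ 2 + d ^+ 2)) +i* ((b * c - a * d) / (c ^+ 2 + d ^+ 2)).
Proof.
rewrite [_ / _](_ : _ = (a +i* b) * ((c / (c ^+ 2 + d ^+ 2)) -i* (d / (c ^+ 2 + d ^+ 2)))) //.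
by simpc; congr (_ +i* _); ring.
Qed.

Definition cden g x : R := (g 1 0 * hre x + g 1 1) ^+ 2 + (g 1 0 * him x) ^+ 2.

Lemma cden_gt0 g x : 0 < \det g -> 0 < cden g x.
Proof.
rewrite det2E /cden => d0; have y0 := him_gt0 x.
have [c0|c0] := eqVneq (g 1 0) 0.
  move: d0; rewrite c0 !mulr0 !mul0r subr0 add0r expr0n /= addr0 => d0.
  by rewrite exprn_even_gt0 //=; apply: contraTneq d0 => ->; rewrite mulr0 ltxx.
by rewrite ltr_wpDl ?sqr_ge0// exprn_even_gt0 //= mulf_neq0// gt_eqF.
Qed.

Lemma mobiusE g x : mobius g (hval x) =
  (((g 0 0 * hre x + g 0 1) * (g 1 0 * hre x + g 1 1) + g 0 0 * g 1 0 * him x ^+ 2) / cden g x)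
  +i* (\det g * him x / cden g x).
Proof.
rewrite /mobius hvalE.
have E a b : (a%:C * (hre x +i* him x) + b%:C)%R = (a * hre x + b) +i* (a * him x).
  by simpc.
rewrite !E complex_divE /cden det2E; congr (_ / _ +i* (_ / _)); ring.
Qed.

Definition act g x : H := hof (mobius g (hval x)).

Lemma hval_act g x : 0 < \det g -> hval (act g x) = mobius g (hval x).
Proof.
by move=> d0; rewrite hofK// mobiusE /= divr_gt0 ?cden_gt0// mulr_gt0// ?him_gt0.
Qed.

Lemma hre_act g x : 0 < \det g -> hre (act g x) =
  ((g 0 0 * hre x + g 0 1) * (g 1 0 * hre x + g 1 1) + g 0 0 * g 1 0 * him x ^+ 2) / cden g x.
Proof. by move=> d0; rewrite /hre hval_act// mobiusE. Qed.

Lemma him_act g x : 0 < \det g -> him (act g x) = \det g * him x / cden g x.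
Proof. by move=> d0; rewrite /him hval_act// mobiusE. Qed.

Lemma mobius_den_neq0 g x : 0 < \det g ->
  (g 1 0)%:C * hval x + (g 1 1)%:C != 0 :> R[i].
Proof.
move=> d0; rewrite hvalE; have := cden_gt0 x d0; rewrite /cden.
apply: contraTneq; simpc => -[-> ->]; by rewrite expr0n /= addr0 ltxx.
Qed.

Lemma act_mul g h x : 0 < \det g -> 0 < \det h -> act (g * h) x = act g (act h x).
Proof.
move=> dg dh; have dgh : 0 < \det (g * h) by rewrite det_mulmx mulr_gt0.
apply: hval_inj; rewrite !hval_act//.
have := mobius_den_neq0 (act h x) dg; have := mobius_den_neq0 x dgh.
have := mobius_den_neq0 x dh.
rewrite /mobius hval_act // /mobius !mul2E !rmorphD !rmorphM /=.
move: (g 0 0)%:C (g 0 1)%:C (g 1 0)%:C (g 1 1)%:C => a b c d.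
move: (h 0 0)%:C (h 0 1)%:C (h 1 0)%:C (h 1 1)%:C (hval x) => a' b' c' d' z n1 n2 _.
field; rewrite n1 /=; apply: contra n2 => /eqP e; apply/eqP; rewrite -e; ring.
Qed.

Lemma act1 x : act 1 x = x.
Proof.
apply: hval_inj; rewrite hval_act ?det1 ?ltr01// /mobius !mxE /=.
by rewrite rmorph1 rmorph0 mul0r add0r addr0 mul1r divr1.
Qed.

Lemma actV g x : 0 < \det g -> act g^-1 (act g x) = x.
Proof.
move=> d0; have gu : g \is a GRing.unit by rewrite unitmxE unitfE gt_eqF.
rewrite -act_mul ?mulVr ?act1// det_inv invr_gt0//.
Qed.

Lemma actKV g x : 0 < \det g -> act g (act g^-1 x) = x.
Proof.
move=> d0; have gu : g \is a GRing.unit by rewrite unitmxE unitfE gt_eqF.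
by rewrite -act_mul ?mulrV ?act1// det_inv invr_gt0.
Qed.

Lemma act_inj g : 0 < \det g -> injective (act g).
Proof. by move=> d0 x y /(congr1 (act g^-1)); rewrite !actV. Qed.

(** This is [2 * (cosh d - 1)], where [d] is the hyperbolic distance: an
    invariant rational function that measures closeness as well as [d] does. *)
Definition hdist x y : R :=
  ((hre x - hre y) ^+ 2 + (him x - him y) ^+ 2) / (him x * him y).

Lemma hdistC x y : hdist x y = hdist y x.
Proof. by rewrite /hdist; congr (_ / _); ring. Qed.

Lemma hdist_act g x y : 0 < \det g -> hdist (act g x) (act g y) = hdist x y.
Proof.
move=> d0; rewrite /hdist !hre_act// !him_act//.
have nx := lt0r_neq0 (cden_gt0 x d0); have ny := lt0r_neq0 (cden_gt0 y d0).
have ix := lt0r_neq0 (him_gt0 x); have iy := lt0r_neq0 (him_gt0 y).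
have d1 := lt0r_neq0 d0.
move: nx ny d1; rewrite det2E /cden => nx ny d1; field.
by rewrite nx ny ix iy d1.
Qed.

Lemma hdist_xx x : hdist x x = 0.
Proof. by rewrite /hdist !subrr expr0n /= addr0 mul0r. Qed.

Lemma nbhs_hdist x e : 0 < e -> nbhs x [set y | hdist x y < e].
Proof.
move=> e0; have c : {for x, continuous (hdist x)}.
  have cr y : {for y, continuous (@hre R)} by exact: continuous_hre.
  have ci y : {for y, continuous (@him R)} by exact: continuous_him.
  apply: contM.
    by apply: contD; apply: contM; apply: contB => //; exact: contcst.
  apply: contV; last by rewrite mulf_neq0// gt_eqF// him_gt0.
  by apply: contM => //; exact: contcst.
have := continuous_dist c e0; apply: filterS => y /=; rewrite hdist_xx subr0 => h.
exact: le_lt_trans (ler_norm _) h.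
Qed.

Lemma derivable_mobius g x : 0 < \det g -> derivable (mobius g : R[i] -> R[i]) (hval x) 1.
Proof.
move=> d0; rewrite /mobius.
have D a b : derivable (fun z : R[i] => a * z + b) (hval x) 1.
  by apply: derivableD; [apply: derivableM; [exact: derivable_cst|exact: derivable_id]|exact: derivable_cst].
apply: derivableM; first exact: D.
apply: derivableV; [exact: mobius_den_neq0 | exact: D].
Qed.

Lemma continuous_act g : 0 < \det g -> continuous (act g).
Proof.
move=> d0 x; apply: continuous_into_half_plane.
have -> : hval (R:=R) \o act g = mobius g \o hval (R:=R) by apply: funext => y /=; rewrite hval_act.
apply: continuous_comp; first exact: continuous_hval.
exact/differentiable_continuous/derivable1_diffP/derivable_mobius.
Qed.

Lemma nbhs_act g x (U : set H) : 0 < \det g -> nbhs (act g x) U -> nbhs x (act g @^-1` U).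
Proof. by move=> d0; exact: continuous_act. Qed.

End Moebius.

(** * Quotients of the half plane as Riemann surfaces *)

Section Holomorphy.
Context {R : realType}.
Local Notation H := (half_plane (R := R)).

Lemma derivable_near (f g : R[i] -> R[i]) (z : R[i]) :
  (\forall w \near z, f w = g w) -> derivable f z 1 -> derivable g z 1.
Proof. exact: near_eq_derivable. Qed.

(** On the open half plane continuity follows from differentiability, and the
    extension [G] of the definition may be taken to be [g \o hof]. *)
Lemma holo_half_plane (U : set H) (g : H -> R[i]) :
  holo U g <-> open U /\ forall x, U x -> derivable (g \o hof : R[i] -> R[i]) (hval x) 1.
Proof.
have int : ([set z : R[i] | 0 < complex.Im z])° = [set z : R[i] | 0 < complex.Im z].
  exact/interior_id/open_upper_half_plane.
split.
  move=> [oU _ [G [oUG dG] Gg]]; split=> // x Ux.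
  apply: (@derivable_near G); last first.
    apply: dG; split; first by exists x.
    by rewrite int; exact: him_gt0.
  have nx : nbhs (hval x) (@hval R @` U).
    by apply: open_nbhs_nbhs; split; [exact: open_hval | exists x].
  apply: filterS nx => _ [y Uy <-] /=; rewrite hvalK; apply: Gg => //.
  by rewrite int; exact: him_gt0.
move=> [oU dg]; split => //.
  apply: continuous_in_subspaceT => x /set_mem Ux.
  have -> : g = (g \o hof) \o @hval R by apply: funext => y /=; rewrite hvalK.
  apply: continuous_comp; first exact: continuous_hval.
  exact/differentiable_continuous/derivable1_diffP/dg.
exists (g \o hof).
  split; first by apply: openI; [exact: open_hval | rewrite int; exact: open_upper_half_plane].
  by move=> _ [[x Ux <-] _]; exact: dg.
by move=> u Uu _; change (g (hof (hval u)) = g u); rewrite hvalK.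
Qed.

Lemma derivable_act (g : 'M[R]_2) (f : H -> R[i]) (x : H) : 0 < \det g ->
  derivable (f \o hof : R[i] -> R[i]) (hval (act g x)) 1 ->
  derivable ((f \o act g) \o hof : R[i] -> R[i]) (hval x) 1.
Proof.
move=> d0 df; apply: (@derivable_near ((f \o hof) \o mobius g)).
  have := open_nbhs_nbhs (conj open_upper_half_plane (him_gt0 x)).
  apply: filterS => z z0 /=; congr f.
  by rewrite -[in LHS](hofK z0) -hval_act// hvalK.
have dm := (derivable1_diffP _ _).1 (derivable_mobius (x := x) d0).
move: df => /derivable1_diffP; rewrite hval_act// => df.
exact: (derivable1_diffP _ _).2 (differentiable_comp dm df).
Qed.

End Holomorphy.

Section OrbitSurface.
Context {R : realType}.
Local Notation H := (half_plane (R := R)).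
Variable G : set 'M[R]_2.

Definition orb_proj (x : H) : orbit_surface G := \pi_{eq_quot (same_orbit_equiv G)} x.

(** Determinant 1 gives positive determinants, hence an action by [act]. *)
Definition special_group := matrix_group G /\ forall g, G g -> \det g = 1.

Lemma orb_proj_surj (p : orbit_surface G) : exists x, orb_proj x = p.
Proof. by exists (repr (p : {eq_quot (same_orbit_equiv G)})); rewrite /orb_proj reprK. Qed.

Lemma continuous_orb_proj : continuous orb_proj.
Proof. exact: (@pi_continuous H {eq_quot (same_orbit_equiv G)}). Qed.

Lemma openE_orbit (U : set (orbit_surface G)) : open U <-> open (orb_proj @^-1` U).
Proof. by []. Qed.

Lemma continuous_orbit (T : topologicalType) (f : orbit_surface G -> T) :
  continuous (f \o orb_proj) -> continuous f.
Proof. exact: (@quotient_continuous H {eq_quot (same_orbit_equiv G)} T f).2. Qed.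

Lemma holo_orbit (U : set (orbit_surface G)) (f : orbit_surface G -> R[i]) :
  holo U f <-> open U /\ forall x, U (orb_proj x) ->
    derivable ((f \o orb_proj) \o hof : R[i] -> R[i]) (hval x) 1.
Proof. exact: (@holo_half_plane R (orb_proj @^-1` U) (f \o orb_proj)). Qed.

Hypothesis sG : special_group.

Lemma special_gt0 g : G g -> 0 < \det g.
Proof. by case: sG => _ d /d ->; exact: ltr01. Qed.

Lemma orbitE (x y : H) : Defs.orbit G x y <-> exists2 g, G g & y = act g x.
Proof.
split=> -[g Gg e]; exists g => //.
  by apply: hval_inj; rewrite hval_act ?special_gt0.
by rewrite e hval_act ?special_gt0.
Qed.

(** As [G] is a group, two orbits are equal as soon as one contains a point of
    the other. *)
Lemma orb_projP (x y : H) : orb_proj x = orb_proj y <-> exists2 g, G g & y = act g x.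
Proof.
have [[G1 GM GV] _] := sG; split.
  move=> /(introT (eqmodP (same_orbit_equiv G) x y)) /asboolP e.
  by apply/orbitE; rewrite e; apply/orbitE; exists 1 => //; rewrite act1.
move=> [g Gg ->]; apply: (elimT (eqmodP (same_orbit_equiv G) x (act g x))).
apply/asboolP/seteqP; split => z.
  move=> /orbitE [h Gh ->]; apply/orbitE; exists (h * g^-1); first exact/GM/GV.
  by rewrite act_mul ?special_gt0// ?actV ?special_gt0//; exact: GV.
move=> /orbitE [h Gh ->]; apply/orbitE; exists (h * g); first exact/GM.
by rewrite act_mul ?special_gt0.
Qed.

Lemma orb_proj_act g x : G g -> orb_proj (act g x) = orb_proj x.
Proof. by move=> Gg; apply/esym/orb_projP; exists g. Qed.

(** The saturation of [U] is the union of its translates. *)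
Lemma open_orb_proj (U : set H) : open U -> open (orb_proj @` U).
Proof.
move=> oU; apply/openE_orbit; rewrite openE => x [y Uy /orb_projP [g Gg xE]].
rewrite xE {x xE} /interior.
have [[_ _ GV] _] := sG; have d0 := special_gt0 (GV _ Gg).
have : nbhs (act g y) (act g^-1 @^-1` U).
  apply: nbhs_act => //; rewrite actV ?special_gt0//; exact: open_nbhs_nbhs.
by apply: filterS => z Uz; exists (act g^-1 z) => //; rewrite orb_proj_act//; exact: GV.
Qed.

Lemma nbhs_orb_proj x (U : set H) : nbhs x U -> nbhs (orb_proj x) (orb_proj @` U).
Proof.
rewrite nbhsE => -[V [oV Vx] VU].
apply: filterS (open_nbhs_nbhs (conj (open_orb_proj oV) _)); first exact: image_subset.
by exists x.
Qed.

Lemma continuous_at_orb_proj (T : topologicalType) (f : orbit_surface G -> T) x :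
  {for x, continuous (f \o orb_proj)} -> {for orb_proj x, continuous f}.
Proof.
move=> cf U /cf nU; change (nbhs (orb_proj x) (f @^-1` U)).
by apply: filterS (nbhs_orb_proj nU) => _ [y Uy <-].
Qed.

End OrbitSurface.

(** * The covering of the annulus by the half plane *)

Section Trigonometry.
Context {R : realType}.
Implicit Types a b : R.

Definition cis a : R[i] := cos a +i* sin a.

Lemma cisD a b : cis (a + b) = cis a * cis b.
Proof. by rewrite /cis; simpc; rewrite cosD sinD; congr (_ +i* _); rewrite addrC mulrC. Qed.

Lemma cis_2pi_int (n : int) a : cis (a + 2 * pi * n%:~R) = cis a.
Proof.
have per k b : cis (b + 2 * pi * k%:R) = cis b.
  rewrite mulr_natr mulr_natl.
  by rewrite /cis (periodicn (@cosD2pi R)) (periodicn (@sinD2pi R)).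
case: n => k; first exact: per.
by rewrite NegzE mulrNz mulrN -[LHS](per k.+1) subrK.
Qed.

Lemma cos_eq1 a : 0 <= a < 2 * pi -> cos a = 1 -> a = 0.
Proof.
move=> /andP[a0 a2]; have pi0 := pi_gt0 R.
have [api|api] := leP a pi => ca.
  by apply: cos_inj; rewrite ?cos0// !in_itv /= ?a0 ?lexx ?pi_ge0.
have : 2 * pi - a = 0; last by lra.
apply: cos_inj; rewrite ?cos0 ?in_itv /= ?lexx ?pi_ge0//; first by apply/andP; split; lra.
have := cis_2pi_int 1 (- a); rewrite /cis mulr1 => -[+ _].
by rewrite cosN addrC => ->.
Qed.

Lemma cis_inj a b : cis a = cis b -> exists n : int, a = b + 2 * pi * n%:~R.
Proof.
move=> [ca sa]; have p2 : 0 < 2 * pi :> R by rewrite mulr_gt0// pi_gt0.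
have c1 : cos (a - b) = 1 by rewrite cosB ca sa -!expr2 cos2Dsin2.
pose n := Num.floor ((a - b) / (2 * pi)); exists n.
have /andP[n1 n2] := floor_itv ((a - b) / (2 * pi)).
have : a - b - 2 * pi * n%:~R = 0; last by lra.
apply: cos_eq1.
  rewrite -/n in n1 n2; move: n1 n2; rewrite ler_pdivlMr// ltr_pdivrMr// intrD mulrDl mul1r.
  by move=> n1 n2; apply/andP; split; lra.
have := cis_2pi_int (- n) (a - b); rewrite /cis => -[+ _].
by rewrite mulrNz mulrN => ->.
Qed.

(** On the right half plane the argument is an arctangent, and hence a
    continuous function. *)
Lemma cis_atan (z : R[i]) : 0 < complex.Re z ->
  z = (Num.sqrt (complex.Re z ^+ 2 + complex.Im z ^+ 2))%:C *
      cis (atan (complex.Im z / complex.Re z)).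
Proof.
case: z => x y /= x0; set k := y / x.
have q0 : Num.sqrt (x ^+ 2 + y ^+ 2) != 0.
  by rewrite gt_eqF// sqrtr_gt0 ltr_pwDl ?sqr_ge0// exprn_gt0.
have cx : cos (atan k) = x / Num.sqrt (x ^+ 2 + y ^+ 2).
  rewrite cos_atan; have -> : 1 + k ^+ 2 = (x ^+ 2 + y ^+ 2) / x ^+ 2.
    by rewrite /k; field; rewrite gt_eqF.
  rewrite sqrtrM ?addr_ge0 ?sqr_ge0// sqrtrV ?sqr_ge0// sqrtr_sqr gtr0_norm//.
  by rewrite invfM invrK mulrC.
have sx : sin (atan k) = y / Num.sqrt (x ^+ 2 + y ^+ 2).
  have := atanK k; rewrite /tan => /(canRL (divfK _)) ->; last first.
    by rewrite cos_atan invr_neq0// gt_eqF// sqrtr_gt0 ltr_pwDl// sqr_ge0.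
  by rewrite cx /k; field; rewrite q0 gt_eqF.
by rewrite /cis cx sx; simpc; congr (_ +i* _); field.
Qed.

End Trigonometry.

Section AnnulusCover.
Context {R : realType}.
Local Notation H := (half_plane (R := R)).
Variable la : R.
Hypothesis la0 : 0 < la.
Implicit Types u v : H.

(** [zlift] and [wlift] are this map precomposed with a Moebius map. *)
Definition annulus_cover u : R[i] := cexp ((0 +i* (pi / la)) * clog (hval u)).

(** The cotangent of the argument of [u]. The cyclic group of an axis preserves
    it, so that it serves as the coordinate across the collars. *)
Definition ctn u : R := hre u / him u.

Definition hmod u : R := Num.sqrt (hre u ^+ 2 + him u ^+ 2).

Definition dil (a : R) u : H := hpt (expR a * hre u) (expR a * him u).

Lemma hmod_gt0 u : 0 < hmod u.
Proof. by rewrite sqrtr_gt0 ltr_wpDl ?sqr_ge0// exprn_gt0// him_gt0. Qed.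

Lemma hmodE u : hmod u = him u * Num.sqrt (1 + ctn u ^+ 2).
Proof.
have y0 := him_gt0 u.
rewrite /hmod -{2}[him u]gtr0_norm// -sqrtr_sqr -sqrtrM ?sqr_ge0//; congr Num.sqrt.
by rewrite /ctn; field; rewrite gt_eqF.
Qed.

(** The argument is the arccotangent of [ctn u]. *)
Lemma carg_hval u : carg (hval u) = pi / 2 - atan (ctn u).
Proof.
have y0 := him_gt0 u; have m0 := hmod_gt0 u.
rewrite /carg -/(him u) ltW// -/(hre u) /cabs normc_def /= -/(hre u) -/(him u) -/(hmod u).
have k1 := atan_gtNpi2 (ctn u); have k2 := atan_ltpi2 (ctn u).
rewrite -[RHS]cosK; last by rewrite in_itv /=; apply/andP; split; lra.
congr acos; rewrite cosB cos_pihalf sin_pihalf mul0r add0r mul1r.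
have := atanK (ctn u); rewrite /tan => /(canRL (divfK _)) ->; last first.
  by rewrite cos_atan invr_neq0// gt_eqF// sqrtr_gt0 ltr_pwDl// sqr_ge0.
have q0 : 0 < Num.sqrt (1 + ctn u ^+ 2) by rewrite sqrtr_gt0 ltr_pwDl// sqr_ge0.
rewrite cos_atan hmodE; move: (Num.sqrt _) q0 => q q0; rewrite /ctn; field.
by rewrite !gt_eqF.
Qed.

Lemma annulus_coverE u : annulus_cover u =
  (expR (- (pi / la * (pi / 2 - atan (ctn u)))))%:C * cis (pi / la * ln (hmod u)).
Proof.
rewrite /annulus_cover /cexp /clog carg_hval /cabs normc_def /=.
rewrite -/(hre u) -/(him u) -/(hmod u) !mul0r sub0r add0r.
by congr (_%:C * _).
Qed.

Lemma cabs_real_cis (r a : R) : 0 <= r -> cabs (r%:C * cis a) = r.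
Proof.
move=> r0; rewrite /cabs normc_def /cis; simpc => /=.
rewrite !exprMn -mulrDr cos2Dsin2 mulr1 sqrtr_sqr ger0_norm//.
Qed.

Lemma cabs_annulus_cover u :
  cabs (annulus_cover u) = expR (- (pi / la * (pi / 2 - atan (ctn u)))).
Proof. by rewrite annulus_coverE cabs_real_cis// expR_ge0. Qed.

Lemma hre_dil a u : hre (dil a u) = expR a * hre u.
Proof. by rewrite hre_pt// mulr_gt0 ?expR_gt0 ?him_gt0. Qed.

Lemma him_dil a u : him (dil a u) = expR a * him u.
Proof. by rewrite him_pt// mulr_gt0 ?expR_gt0 ?him_gt0. Qed.

Lemma ctn_dil a u : ctn (dil a u) = ctn u.
Proof. by rewrite /ctn hre_dil him_dil; field; rewrite !gt_eqF ?expR_gt0 ?him_gt0. Qed.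

Lemma hmod_dil a u : hmod (dil a u) = expR a * hmod u.
Proof. by rewrite !hmodE ctn_dil him_dil mulrA. Qed.

Lemma dilD a b u : dil a (dil b u) = dil (a + b) u.
Proof. by apply: half_plane_eq; rewrite ?hre_dil ?him_dil expRD mulrA. Qed.

Lemma dil0 u : dil 0 u = u.
Proof. by apply: half_plane_eq; rewrite ?hre_dil ?him_dil expR0 mul1r. Qed.

Lemma annulus_cover_dil (n : int) u :
  annulus_cover (dil (2 * la * n%:~R) u) = annulus_cover u.
Proof.
rewrite !annulus_coverE ctn_dil hmod_dil lnM ?posrE ?expR_gt0 ?hmod_gt0// expRK.
rewrite -[in RHS](cis_2pi_int n); congr (_ * cis _); field.
by rewrite gt_eqF.
Qed.

Lemma annulus_cover_ctn_inj u v :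
  cabs (annulus_cover u) = cabs (annulus_cover v) -> ctn u = ctn v.
Proof.
rewrite !cabs_annulus_cover => /expR_inj/oppr_inj/mulfI.
have pl : pi / la != 0 by rewrite gt_eqF// divr_gt0// pi_gt0.
move=> /(_ pl)/addrI/oppr_inj e.
by rewrite -(atanK (ctn u)) e atanK.
Qed.

(** The modulus determines the argument of [u], and the phase determines the
    logarithm of its modulus up to a multiple of [2 * la]. *)
Lemma annulus_cover_inj u v : annulus_cover u = annulus_cover v ->
  exists n : int, u = dil (2 * la * n%:~R) v.
Proof.
move=> uv; have cuv := annulus_cover_ctn_inj (congr1 cabs uv).
have pl : pi / la != 0 by rewrite gt_eqF// divr_gt0// pi_gt0.
move: uv; rewrite !annulus_coverE cuv => /mulfI h.
have /h/cis_inj[n e] : (expR (- (pi / la * (pi / 2 - atan (ctn v)))))%:C != 0.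
  by rewrite eq_complex /= eqxx andbT gt_eqF// expR_gt0.
have {}e : ln (hmod u) = 2 * la * n%:~R + ln (hmod v).
  apply: (mulfI pl); rewrite e; have pi0 := pi_gt0 R.
  by move: (pi) pi0 => p p0; field; rewrite !gt_eqF.
exists n; have := lnK (hmod_gt0 u); rewrite e expRD lnK ?posrE ?hmod_gt0//.
rewrite !hmodE -cuv mulrA => /mulIf h2.
have {h2}iu : him u = expR (2 * la * n%:~R) * him v.
  by rewrite h2// gt_eqF// sqrtr_gt0 ltr_pwDl// sqr_ge0.
apply: half_plane_eq; rewrite ?him_dil// hre_dil.
have : hre u = ctn u * him u by rewrite /ctn divfK// gt_eqF// him_gt0.
rewrite cuv iu => ->; rewrite mulrCA; congr (_ * _).
by rewrite /ctn divfK// gt_eqF// him_gt0.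
Qed.

Lemma annulus_cover_range u :
  round_annulus (critical_modulus la) 1 (annulus_cover u).
Proof.
rewrite /round_annulus /= cabs_annulus_cover /critical_modulus ltr_expR.
have k1 := atan_gtNpi2 (ctn u); have k2 := atan_ltpi2 (ctn u).
have pl : 0 < pi / la by rewrite divr_gt0// pi_gt0.
have a0 : 0 < pi / 2 - atan (ctn u) by lra.
have -> : expR (- (pi / la * (pi / 2 - atan (ctn u)))) < 1.
  by rewrite expR_lt1 oppr_lt0 mulr_gt0.
rewrite andbT ltrN2 (_ : pi ^+ 2 / la = pi / la * pi); last by rewrite expr2 mulrAC.
by rewrite ltr_pM2l//; lra.
Qed.

(** The modulus of [annulus_cover u] increases with [ctn u], so the sectors
    [ctn < a] are neighbourhoods of the end that lies over the negative reals. *)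
Lemma annulus_cover_collar (a : R) : exists2 r, critical_modulus la < r &
  forall u, cabs (annulus_cover u) < r -> ctn u < a.
Proof.
have k1 := atan_gtNpi2 a; have k2 := atan_ltpi2 a.
have pl : 0 < pi / la by rewrite divr_gt0// pi_gt0.
exists (expR (- (pi / la * (pi / 2 - atan a)))).
  rewrite ltr_expR ltrN2 (_ : pi ^+ 2 / la = pi / la * pi); last by rewrite expr2 mulrAC.
  by rewrite ltr_pM2l//; lra.
move=> u; rewrite cabs_annulus_cover ltr_expR ltrN2 ltr_pM2l// ltrD2l ltrN2 => h.
by rewrite ltNge; apply: contraTN h => /le_atan; rewrite -leNgt.
Qed.

Lemma annulus_cover_neq0 u : annulus_cover u != 0.
Proof.
apply/eqP => e; have := cabs_annulus_cover u; rewrite e /cabs normr0 /= => /eqP.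
by rewrite lt_eqF// expR_gt0.
Qed.

(** Opposite cotangents mean supplementary arguments, whence the product of the
    moduli; the logarithms of the moduli of [u] and [v] add up to [k], whence
    the phase. This is where the critical modulus of the parameter comes from. *)
Lemma annulus_cover_opp (k : R) u v : ctn v = - ctn u -> hmod v = expR k / hmod u ->
  annulus_cover u * annulus_cover v = (critical_modulus la)%:C * cis (pi / la * k).
Proof.
move=> cv mv; rewrite !annulus_coverE cv mv atanN lnM ?posrE ?expR_gt0 ?invr_gt0 ?hmod_gt0//.
rewrite expRK lnV ?posrE ?hmod_gt0// mulrACA -cisD -rmorphM -expRD; congr (_%:C * cis _).
  rewrite /critical_modulus; congr expR.
  by move: (pi) (atan _) => p a; field; rewrite gt_eqF.
by move: (pi) => p; field; rewrite gt_eqF.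
Qed.

End AnnulusCover.

(** * The matrices of the construction *)

Section Matrices.
Context {R : realType}.
Local Notation H := (half_plane (R := R)).
Variables la tau : R.
Hypothesis la0 : 0 < la.
Implicit Types x : H.
Local Notation c := (cosh (la / 2)).
Local Notation s := (sinh (la / 2)).

Lemma hyp_add : c + s = expR (la / 2).
Proof. by rewrite /cosh /sinh; field. Qed.

Lemma hyp_sub : c - s = expR (- (la / 2)).
Proof. by rewrite /cosh /sinh; field. Qed.

Lemma sinh_half_gt0 : 0 < s.
Proof.
rewrite /sinh divr_gt0// subr_gt0 ltr_expR.
by move: la0; lra.
Qed.

Lemma cosh_half_gt0 : 0 < c.
Proof. by rewrite /cosh divr_gt0// addr_gt0 ?expR_gt0. Qed.

Lemma hyp_pythagoras : c ^+ 2 - s ^+ 2 = 1.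
Proof. by rewrite subr_sqr hyp_add hyp_sub mulrC -expRD addrN expR0. Qed.

Lemma expR_la : expR la = (c + s) ^+ 2.
Proof. by rewrite hyp_add expr2 -expRD; congr expR; field. Qed.

Lemma expRN_la : expR (- la) = (c - s) ^+ 2.
Proof. by rewrite hyp_sub expr2 -expRD; congr expR; field. Qed.

Lemma cosh_la : cosh la = c ^+ 2 + s ^+ 2.
Proof. by rewrite [LHS]/cosh expR_la expRN_la; field. Qed.

Lemma coshD1 : cosh la + 1 = 2 * c ^+ 2.
Proof. by rewrite cosh_la; have := hyp_pythagoras; move: c s => C S'; lra. Qed.

Lemma coshB1 : cosh la - 1 = 2 * s ^+ 2.
Proof. by rewrite cosh_la; have := hyp_pythagoras; move: c s => C S'; lra. Qed.

Lemma scale2E (a : R) (g : 'M[R]_2) (i j : 'I_2) : (a *: g) i j = a * g i j.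
Proof. by rewrite !mxE. Qed.

(* The Moebius maps inside [zlift] and [wlift]. *)
Definition matMz : 'M[R]_2 := matrix2 s c (- s) c.
Definition matMw : 'M[R]_2 := matrix2 c (- s) c s.

Lemma matrix2E (a b c' d : R) : (matrix2 a b c' d 0 0 = a) * (matrix2 a b c' d 0 1 = b)
  * (matrix2 a b c' d 1 0 = c') * (matrix2 a b c' d 1 1 = d).
Proof. by rewrite /matrix2 !mxE. Qed.

Lemma det_matrix2 (a b c' d : R) : \det (matrix2 a b c' d) = a * d - b * c'.
Proof. by rewrite det2E !matrix2E. Qed.

Lemma det_Mz : 0 < \det matMz.
Proof.
have := sinh_half_gt0; have := cosh_half_gt0; rewrite det_matrix2 => ? ?.
by rewrite mulrN opprK addr_gt0// mulr_gt0.
Qed.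

Lemma det_Mw : 0 < \det matMw.
Proof.
have := sinh_half_gt0; have := cosh_half_gt0; rewrite det_matrix2 => ? ?.
by rewrite mulNr opprK addr_gt0// mulr_gt0.
Qed.

Lemma det_S : \det (matS la) = 1.
Proof. by rewrite det_matrix2 cosh_la; have := hyp_pythagoras; nra. Qed.

Lemma det_S' : \det (matS' la) = 1.
Proof. by rewrite det_matrix2 cosh_la; have := hyp_pythagoras; nra. Qed.

Lemma cosh2Bsinh2 (a : R) : cosh a ^+ 2 - sinh a ^+ 2 = 1.
Proof.
rewrite /cosh /sinh; have := expRxMexpNx_1 a; move: (expR a) (expR (- a)) => u v uv.
have -> : ((u + v) / 2) ^+ 2 - ((u - v) / 2) ^+ 2 = u * v by field.
by [].
Qed.

Lemma det_T : \det (matT la tau) = 1.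
Proof.
rewrite det_matrix2 -[RHS](cosh2Bsinh2 (tau / 2)) /coth /tanh; field.
by rewrite !gt_eqF ?sinh_half_gt0 ?cosh_half_gt0.
Qed.

Lemma zliftE x : zlift la x = annulus_cover la (act matMz x).
Proof.
have e : mobius matMz (hval x) = (hval x * s%:C + c%:C) / (- hval x * s%:C + c%:C).
  by rewrite /mobius !matrix2E rmorphN /= !mulNr !(mulrC (hval x)).
by rewrite /annulus_cover hval_act ?det_Mz// e.
Qed.

Lemma wliftE x : wlift la x = annulus_cover la (act matMw x).
Proof.
have e : mobius matMw (hval x) = (hval x * c%:C - s%:C) / (hval x * c%:C + s%:C).
  by rewrite /mobius !matrix2E rmorphN /= !(mulrC (hval x)).
by rewrite /annulus_cover hval_act ?det_Mw// e.
Qed.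

(* The matrix has the square roots of the multiplier of [dil] as entries. *)
Lemma dil_act (a : R) (u : H) : dil (2 * a) u = act (matrix2 (expR a) 0 0 (expR (- a))) u.
Proof.
have d : \det (matrix2 (expR a) 0 0 (expR (- a))) = 1.
  by rewrite det_matrix2 mul0r subr0 expRxMexpNx_1.
have e2 : expR (2 * a) = expR a ^+ 2 by rewrite expr2 -expRD; congr expR; ring.
have ea : expR a = (expR (- a))^-1 by rewrite expRN invrK.
have e0 := lt0r_neq0 (expR_gt0 (- a)).
apply: half_plane_eq.
  by rewrite hre_dil hre_act ?d ?ltr01// /cden !matrix2E e2 ea; field.
by rewrite him_dil him_act ?d ?ltr01// /cden !matrix2E e2 ea; field.
Qed.

Lemma act_Mz_S x : act matMz (act (matS la) x) = dil (2 * la) (act matMz x).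
Proof.
have dD : \det (matrix2 (expR la) 0 0 (expR (- la))) = 1.
  by rewrite det_matrix2 mul0r subr0 expRxMexpNx_1.
have e : matMz * matS la = matrix2 (expR la) 0 0 (expR (- la)) * matMz.
  by apply: matrix2_eq; rewrite !mul2E !matrix2E ?coshD1 ?coshB1 ?cosh_la
    ?expR_la ?expRN_la; move: c s => C S'; ring.
by rewrite dil_act -[LHS]act_mul ?det_Mz ?det_S ?ltr01// e act_mul ?dD ?ltr01// det_Mz.
Qed.

Lemma act_Mw_S' x : act matMw (act (matS' la) x) = dil (2 * - la) (act matMw x).
Proof.
have dD : \det (matrix2 (expR (- la)) 0 0 (expR (- - la))) = 1.
  by rewrite det_matrix2 mul0r subr0 expRxMexpNx_1.
have e : matMw * matS' la = matrix2 (expR (- la)) 0 0 (expR (- - la)) * matMw.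
  by apply: matrix2_eq; rewrite !mul2E !matrix2E ?opprK ?coshD1 ?coshB1 ?cosh_la
    ?expR_la ?expRN_la; move: c s => C S'; ring.
by rewrite dil_act -[LHS]act_mul ?det_Mw ?det_S' ?ltr01// e act_mul ?dD ?ltr01// det_Mw.
Qed.

Lemma act_scale (a : R) (g : 'M[R]_2) x : a != 0 -> act (a *: g) x = act g x.
Proof.
move=> a0; rewrite /act; congr hof; rewrite /mobius !mxE !rmorphM -!mulrA -!mulrDr.
have n : a%:C != 0 :> R[i] by rewrite eq_complex /= eqxx andbT.
by rewrite invfM mulrACA mulfV// mul1r.
Qed.

(** Read in the two charts, [T] exchanges the sides of an axis: it becomes
    [u |-> - expR (- tau) / u]. The twist appears as the factor [expR (- tau)].
    *)
Lemma act_Mz_T x : act matMz (act (matT la tau) x) =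
  act (matrix2 0 (- expR (- tau)) 1 0) (act matMw x).
Proof.
have dD : 0 < \det (matrix2 0 (- expR (- tau)) 1 0 : 'M[R]_2).
  by rewrite det_matrix2 mul0r sub0r mulr1 opprK expR_gt0.
pose e := expR (tau / 2); pose f := expR (- (tau / 2)).
have ef : e * f = 1 by rewrite expRxMexpNx_1.
have f2 : expR (- tau) = f ^+ 2 by rewrite expr2 -expRD; congr expR; field.
have chE : cosh (tau / 2) = (e + f) / 2 by [].
have shE : sinh (tau / 2) = (e - f) / 2 by [].
have s0 := lt0r_neq0 sinh_half_gt0; have c0 := lt0r_neq0 cosh_half_gt0.
have f0 : - f != 0 by rewrite oppr_eq0 gt_eqF// expR_gt0.
have fe : e = f^-1 by rewrite /e /f expRN invrK.
(* The two matrices are proportional and not equal. *)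
have E : matrix2 0 (- expR (- tau)) 1 0 * matMw = (- f) *: (matMz * matT la tau).
  move: f0; rewrite oppr_eq0 => f1.
  apply: matrix2_eq; rewrite [RHS]scale2E !mul2E !matrix2E ?f2 chE shE /coth /tanh fe; field;
    by rewrite ?f1 ?s0 ?c0.
rewrite -[RHS]act_mul ?det_Mw// E act_scale// act_mul ?det_Mz// det_T//.
Qed.

Lemma neg_inv_gt0 (k : R) : 0 < k -> 0 < \det (matrix2 0 (- k) 1 0 : 'M[R]_2).
Proof. by move=> k0; rewrite det_matrix2 mul0r sub0r mulr1 opprK. Qed.

Lemma ctn_neg_inv (k : R) (u : H) : 0 < k -> ctn (act (matrix2 0 (- k) 1 0) u) = - ctn u.
Proof.
move=> k0; have dD := neg_inv_gt0 k0.
rewrite /ctn hre_act// him_act// det_matrix2 /cden !matrix2E.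
have y0 := lt0r_neq0 (him_gt0 u).
have : hre u ^+ 2 + him u ^+ 2 != 0 by rewrite gt_eqF// ltr_wpDl ?sqr_ge0// exprn_gt0// him_gt0.
move: (hre u) (him u) y0 => p y y0 n; field.
by rewrite y0 n gt_eqF.
Qed.

Lemma hmod_neg_inv (k : R) (u : H) : 0 < k -> hmod (act (matrix2 0 (- k) 1 0) u) = k / hmod u.
Proof.
move=> k0; have dD := neg_inv_gt0 k0.
have m0 := hmod_gt0 u; have y0 := him_gt0 u.
rewrite hmodE ctn_neg_inv// sqrrN him_act// det_matrix2 /cden !matrix2E.
have -> : Num.sqrt (1 + ctn u ^+ 2) = hmod u / him u by rewrite hmodE mulrC mulKf// gt_eqF.
have -> : (1 * hre u + 0) ^+ 2 + (1 * him u) ^+ 2 = hmod u ^+ 2.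
  by rewrite /hmod sqr_sqrtr ?addr_ge0 ?sqr_ge0// addr0 !mul1r.
by move: (hmod u) m0 => m m0; field; rewrite !gt_eqF.
Qed.

Lemma ctn_Mz_T x : ctn (act matMz (act (matT la tau) x)) = - ctn (act matMw x).
Proof. by rewrite act_Mz_T ctn_neg_inv// expR_gt0. Qed.

(** The lifted form of the equation [z * w = t], with [x] in the chart of [w]
    and [T x] in the chart of [z]. *)
Lemma zw_T x : zlift la (act (matT la tau) x) * wlift la x =
  (critical_modulus la)%:C * cis (pi / la * - tau).
Proof.
rewrite zliftE wliftE mulrC; apply: annulus_cover_opp => //; first exact: ctn_Mz_T.
by rewrite act_Mz_T hmod_neg_inv// expR_gt0.
Qed.

(** The collars [ctn < collar_width] reach across the geodesics [ctn = 0].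
    With this bound the conditions on a point [x] become
    [c ^+ 2 - s ^+ 2 * r ^+ 2 < him x] and [c ^+ 2 * r ^+ 2 - s ^+ 2 < him x], where
    [r] is the modulus of [x]. *)
Definition collar_width : R := (2 * s * c)^-1.

Lemma collar_width_gt0 : 0 < collar_width.
Proof.
by rewrite invr_gt0; apply: mulr_gt0; [apply: mulr_gt0|exact: cosh_half_gt0];
  [exact: ltr0n|exact: sinh_half_gt0].
Qed.

Lemma ctn_Mz x : ctn (act matMz x) =
  (c ^+ 2 - s ^+ 2 * (hre x ^+ 2 + him x ^+ 2)) / him x * collar_width.
Proof.
have D := cden_gt0 x det_Mz.
have y0 := him_gt0 x; have s0 := sinh_half_gt0; have c0 := cosh_half_gt0.
rewrite /ctn hre_act ?det_Mz// him_act ?det_Mz// det_matrix2.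
have n : cden matMz x != 0 by rewrite gt_eqF.
rewrite !matrix2E /collar_width; move: (cden _ _) n => d n.
move: c s c0 s0 (hre x) (him x) y0 => C S' c0 s0 p y y0; field.
by rewrite n !gt_eqF//; nra.
Qed.

Lemma ctn_Mw x : ctn (act matMw x) =
  (c ^+ 2 * (hre x ^+ 2 + him x ^+ 2) - s ^+ 2) / him x * collar_width.
Proof.
have D := cden_gt0 x det_Mw.
have y0 := him_gt0 x; have s0 := sinh_half_gt0; have c0 := cosh_half_gt0.
rewrite /ctn hre_act ?det_Mw// him_act ?det_Mw// det_matrix2.
have n : cden matMw x != 0 by rewrite gt_eqF.
rewrite !matrix2E /collar_width; move: (cden _ _) n => d n.
move: c s c0 s0 (hre x) (him x) y0 => C S' c0 s0 p y y0; field.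
by rewrite n !gt_eqF//; nra.
Qed.

Lemma collar_z x : (ctn (act matMz x) < collar_width) =
  (c ^+ 2 - s ^+ 2 * (hre x ^+ 2 + him x ^+ 2) < him x).
Proof.
rewrite ctn_Mz -{2}[collar_width]mul1r ltr_pM2r ?collar_width_gt0//.
by rewrite ltr_pdivrMr ?him_gt0// mul1r.
Qed.

Lemma collar_w x : (ctn (act matMw x) < collar_width) =
  (c ^+ 2 * (hre x ^+ 2 + him x ^+ 2) - s ^+ 2 < him x).
Proof.
rewrite ctn_Mw -{2}[collar_width]mul1r ltr_pM2r ?collar_width_gt0//.
by rewrite ltr_pdivrMr ?him_gt0// mul1r.
Qed.

Lemma hmod_bounds x : [/\ him x <= hmod x, 0 < hmod x,
  hmod x ^+ 2 = hre x ^+ 2 + him x ^+ 2 & `|hre x| <= hmod x].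
Proof.
split; first 1 last.
- exact: hmod_gt0.
- by rewrite /hmod sqr_sqrtr// addr_ge0 ?sqr_ge0.
- by rewrite -sqrtr_sqr ler_wsqrtr// lerDl sqr_ge0.
by rewrite -[leLHS]gtr0_norm ?him_gt0// -sqrtr_sqr ler_wsqrtr// lerDr sqr_ge0.
Qed.

(** As [him x <= r], the first condition factors to give [1 < r] and the second
    one to give [r < 1]. *)
Lemma collars_disjoint x : ctn (act matMz x) < collar_width ->
  ctn (act matMw x) < collar_width -> False.
Proof.
rewrite collar_z collar_w; have [yr r0 <- _] := hmod_bounds x.
move: (hmod x) yr r0 => r yr r0.
have := hyp_pythagoras; have := sinh_half_gt0; have := cosh_half_gt0.
have := him_gt0 x; move: c s (him x) yr => C S' y yr y0 C0 S0 e h1 h2.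
have r1 : 1 < r.
  rewrite ltNge; apply/negP => r1.
  have : (1 - r) * (S' ^+ 2 * r + C ^+ 2) < 0 by nra.
  by rewrite ltNge mulr_ge0// ?subr_ge0//; nra.
have : (r - 1) * (C ^+ 2 * r + S' ^+ 2) < 0 by nra.
by rewrite ltNge mulr_ge0// ?subr_ge0 1?ltW//; nra.
Qed.

Lemma hmod2_act g x : 0 < \det g -> hmod (act g x) ^+ 2 =
  ((g 0 0 * hre x + g 0 1) ^+ 2 + (g 0 0 * him x) ^+ 2) / cden g x.
Proof.
move=> d0; rewrite /hmod sqr_sqrtr ?addr_ge0 ?sqr_ge0// hre_act// him_act// det2E.
have n : cden g x != 0 by rewrite gt_eqF// cden_gt0.
apply: (mulIf n); rewrite divfK//.
move: n; rewrite /cden => n; field.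
by [].
Qed.

Lemma far_act g x : 0 < \det g -> la <= `|ln (hmod (act g x))| ->
  let N := (g 0 0 * hre x + g 0 1) ^+ 2 + (g 0 0 * him x) ^+ 2 in
  expR la * cden g x <= expR (- la) * N \/ expR la * N <= expR (- la) * cden g x.
Proof.
move=> d0 h N; have m0 := hmod_gt0 (act g x); have D0 := cden_gt0 x d0.
have NE : N = hmod (act g x) ^+ 2 * cden g x by rewrite hmod2_act// divfK// gt_eqF.
have e0 := expR_gt0 la; have f0 := expR_gt0 (- la); have ef := expRxMexpNx_1 la.
move: h; rewrite ler_normr => /orP[h|h]; [left|right]; rewrite NE mulrA.
  apply: ler_wpM2r; first exact: ltW.
  have hm : expR la <= hmod (act g x) by rewrite -(lnK m0) ler_expR.
  have h2 : expR la ^+ 2 <= hmod (act g x) ^+ 2 by rewrite ler_sqr// nnegrE ltW.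
  have -> : expR la = expR (- la) * expR la ^+ 2 by rewrite expr2 mulrA (mulrC (expR (- la))) ef mul1r.
  by rewrite ler_wpM2l// ltW.
apply: ler_wpM2r; first exact: ltW.
have hm : hmod (act g x) <= expR (- la) by rewrite -(lnK m0) ler_expR lerNr.
have h2 : hmod (act g x) ^+ 2 <= expR (- la) ^+ 2 by rewrite ler_sqr// nnegrE ltW.
have -> : expR (- la) = expR la * expR (- la) ^+ 2 by rewrite expr2 mulrA ef mul1r.
by rewrite ler_wpM2l// ltW.
Qed.

(** The points in question form two disks, cut off by the perpendiculars to the
    axis of [S] at distance [la] from the imaginary axis. Clearing denominators
    gives their equations, one for each sign of [hre x]. *)
Lemma far_z x : la <= `|ln (hmod (act matMz x))| ->
  s ^+ 2 * (hre x ^+ 2 + him x ^+ 2) + c ^+ 2 <= (c ^+ 2 + s ^+ 2) * `|hre x|.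
Proof.
move=> /(far_act det_Mz); rewrite /cden !matrix2E expR_la expRN_la.
have := sinh_half_gt0; have := cosh_half_gt0.
move: c s (hre x) (him x) => C S' p y C0 S0 h.
have cs : 0 < 4 * C * S' by rewrite !mulr_gt0.
rewrite -(ler_pM2l cs); case: h => h.
  by apply: (@le_trans _ _ (4 * C * S' * ((C ^+ 2 + S' ^+ 2) * p))); [lra|
    rewrite ler_pM2l// ler_wpM2l ?ler_norm// addr_ge0 ?sqr_ge0].
by apply: (@le_trans _ _ (4 * C * S' * ((C ^+ 2 + S' ^+ 2) * - p))); [lra|
  rewrite ler_pM2l// ler_wpM2l ?addr_ge0 ?sqr_ge0// -normrN ler_norm].
Qed.

Lemma far_w x : la <= `|ln (hmod (act matMw x))| ->
  c ^+ 2 * (hre x ^+ 2 + him x ^+ 2) + s ^+ 2 <= (c ^+ 2 + s ^+ 2) * `|hre x|.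
Proof.
move=> /(far_act det_Mw); rewrite /cden !matrix2E expR_la expRN_la.
have := sinh_half_gt0; have := cosh_half_gt0.
move: c s (hre x) (him x) => C S' p y C0 S0 h.
have cs : 0 < 4 * C * S' by rewrite !mulr_gt0.
rewrite -(ler_pM2l cs); case: h => h.
  by apply: (@le_trans _ _ (4 * C * S' * ((C ^+ 2 + S' ^+ 2) * - p))); [lra|
    rewrite ler_pM2l// ler_wpM2l ?addr_ge0 ?sqr_ge0// -normrN ler_norm].
by apply: (@le_trans _ _ (4 * C * S' * ((C ^+ 2 + S' ^+ 2) * p))); [lra|
  rewrite ler_pM2l// ler_wpM2l ?ler_norm// addr_ge0 ?sqr_ge0].
Qed.

(** The disks of one axis do not meet those of the other: adding their
    inequalities gives [(1 - `|hre x|) ^+ 2 + him x ^+ 2 <= 0]. They touch at the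
    ideal points 1 and -1, which makes the puncture. *)
Lemma not_far_zw x : la <= `|ln (hmod (act matMz x))| ->
  la <= `|ln (hmod (act matMw x))| -> False.
Proof.
move=> /far_z h1 /far_w h2.
have := hyp_pythagoras; have := sinh_half_gt0; have := cosh_half_gt0.
have := him_gt0 x; move: c s h1 h2 => C S' h1 h2 y0 C0 S0 e.
have p2 : hre x ^+ 2 = `|hre x| ^+ 2 by rewrite -normrX ger0_norm ?sqr_ge0.
rewrite p2 in h1 h2.
have : (C ^+ 2 + S' ^+ 2) * ((1 - `|hre x|) ^+ 2 + him x ^+ 2) <= 0 by nra.
have i2 : 0 < him x ^+ 2 by rewrite exprn_gt0.
apply/negP; rewrite -ltNge mulr_gt0//.
  by rewrite addr_gt0 ?exprn_gt0.
by rewrite ltr_wpDl ?sqr_ge0.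
Qed.

Lemma collar_z_near_w x : ctn (act matMz x) < collar_width ->
  `|ln (hmod (act matMw x))| < la.
Proof.
rewrite collar_z => h1; rewrite ltNge; apply/negP => /far_w h2.
have [yr r0 re pr] := hmod_bounds x; rewrite -re in h1 h2.
move: (hmod x) yr r0 pr h1 h2 {re} => r yr r0 pr h1 h2.
have := hyp_pythagoras; have := sinh_half_gt0; have := cosh_half_gt0.
have := him_gt0 x; move: c s (him x) yr h1 h2 => C S' y yr h1 h2 y0 C0 S0 e.
have h3 : (r - 1) * (C ^+ 2 * r - S' ^+ 2) <= 0 by nra.
have r1 : r <= 1.
  rewrite leNgt; apply/negP => r1; move: h3; apply/negP; rewrite -ltNge mulr_gt0 ?subr_gt0//; nra.
have : (1 - r) * (S' ^+ 2 * r + C ^+ 2) < 0 by nra.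
by rewrite ltNge mulr_ge0// ?subr_ge0//; nra.
Qed.

Lemma collar_w_near_z x : ctn (act matMw x) < collar_width ->
  `|ln (hmod (act matMz x))| < la.
Proof.
rewrite collar_w => h1; rewrite ltNge; apply/negP => /far_z h2.
have [yr r0 re pr] := hmod_bounds x; rewrite -re in h1 h2.
move: (hmod x) yr r0 pr h1 h2 {re} => r yr r0 pr h1 h2.
have := hyp_pythagoras; have := sinh_half_gt0; have := cosh_half_gt0.
have := him_gt0 x; move: c s (him x) yr h1 h2 => C S' y yr h1 h2 y0 C0 S0 e.
have h3 : (r - 1) * (S' ^+ 2 * r - C ^+ 2) <= 0 by nra.
have r1 : 1 <= r.
  rewrite leNgt; apply/negP => r1; move: h3; apply/negP; rewrite -ltNge nmulr_lgt0 ?subr_lt0//; nra.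
have : (r - 1) * (C ^+ 2 * r + S' ^+ 2) < 0 by nra.
by rewrite ltNge mulr_ge0// ?subr_ge0//; nra.
Qed.

End Matrices.

(** * Ping-pong for the free group of the punctured cylinder *)

Section GeneratedGroup.
Context {R : realType}.
Implicit Types A : set 'M[R]_2.

Lemma group_generated_group A : matrix_group (group_generated A).
Proof.
split=> [G [[G1 _ _] _] //|g h Ag Ah G GA|g Ag G GA].
  by case: (GA.1) => _ GM _; apply: GM; [exact: Ag|exact: Ah].
by case: (GA.1) => _ _ GV; apply: GV; exact: Ag.
Qed.

Lemma group_generated_sub A : A `<=` group_generated A.
Proof. exact: sub_gen_smallest. Qed.

Lemma group_generated_min A G : matrix_group G -> A `<=` G -> group_generated A `<=` G.
Proof. exact: smallest_sub. Qed.

Lemma special_group_generated A : (forall g, A g -> \det g = 1) ->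
  special_group (group_generated A).
Proof.
move=> A1; split; first exact: group_generated_group.
apply: (group_generated_min (G := [set g | \det g = 1])) => //; split => /=.
  exact: det1.
  by move=> g h g1 h1; rewrite det_mulmx g1 h1 mulr1.
by move=> g g1; rewrite det_inv g1 invr1.
Qed.

End GeneratedGroup.

Section PingPong.
Context {R : realType}.
Local Notation H := (half_plane (R := R)).
Variable la : R.
Hypothesis la0 : 0 < la.
Implicit Types (x : H) (i : bool).
Local Notation G0 := (groupG0 la).

Lemma special_G0 : special_group G0.
Proof. by apply: special_group_generated => g [->|->]; [exact: det_S|exact: det_S']. Qed.

(** [chart i] maps the axis of [gen i] to the imaginary axis and the end of the
    quotient beyond this axis to the side of negative real part. The value
    [true] stands for the end of [z] and [false] for that of [w]. *)
Definition chart i : 'M[R]_2 := if i then matMz la else matMw la.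

Lemma det_chart i : 0 < \det (chart i).
Proof. by case: i; [exact: det_Mz|exact: det_Mw]. Qed.

(* The inverse makes both generators act as [dil (2 * la)] in their charts. *)
Definition gen i : 'M[R]_2 := if i then matS la else (matS' la)^-1.

Lemma G0_gen i : G0 (gen i).
Proof.
have [[_ _ GV] _] := special_G0.
by case: i; [apply: group_generated_sub; left | apply: GV; apply: group_generated_sub; right].
Qed.

Lemma chart_gen i x : act (chart i) (act (gen i) x) = dil (2 * la) (act (chart i) x).
Proof.
case: i => /=; first exact: act_Mz_S.
rewrite -{2}[x](actKV (g := matS' la)) ?det_S' ?ltr01//.
by rewrite act_Mw_S'// dilD mulrN addrN dil0.
Qed.

Lemma chart_power i (n : int) : exists2 g, G0 g &
  forall x, act (chart i) (act g x) = dil (2 * la * n%:~R) (act (chart i) x).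
Proof.
have [[G1 GM GV] _] := special_G0; have gt := special_gt0 special_G0.
have nat (k : nat) : exists2 g, G0 g &
  forall x, act (chart i) (act g x) = dil (2 * la * k%:R) (act (chart i) x).
  elim: k => [|k [g Gg gE]]; first by exists 1 => // x; rewrite act1 mulr0 dil0.
  exists (gen i * g); first by apply: GM => //; exact: G0_gen.
  move=> x; rewrite act_mul ?gt//; last exact: G0_gen.
  by rewrite chart_gen gE dilD -[k.+1]addn1 natrD mulrDr mulr1 addrC.
case: n => k; first exact: nat.
have [g Gg gE] := nat k.+1; exists g^-1; first exact: GV.
move=> x; rewrite -{2}[x](actKV (g := g)) ?gt// gE dilD NegzE mulrNz mulrN.
by rewrite addNr dil0.
Qed.

(** The signed distance, along the axis of [gen i], between the foot of [x] and
    the common perpendicular of the two axes. *)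
Definition height i x : R := ln (hmod (act (chart i) x)).

Lemma height_dil i x y a : act (chart i) y = dil a (act (chart i) x) ->
  height i y = a + height i x.
Proof. by move=> e; rewrite /height e hmod_dil lnM ?posrE ?expR_gt0 ?hmod_gt0// expRK. Qed.

Definition collar i (a : R) : set H := [set x | ctn (act (chart i) x) < a].

Local Notation width := (collar_width la).

Lemma not_far i x : la <= `|height i x| -> la <= `|height (~~ i) x| -> False.
Proof. by case: i => h1 h2; [apply: not_far_zw h1 h2|apply: not_far_zw h2 h1]. Qed.

Lemma collar_near i x : collar i width x -> `|height (~~ i) x| < la.
Proof. by case: i => h; [exact: collar_z_near_w|exact: collar_w_near_z]. Qed.

Lemma collarsI x : collar true width x -> collar false width x -> False.
Proof. exact: collars_disjoint. Qed.

Definition letter (l : bool * bool) : 'M[R]_2 := if l.2 then gen l.1 else (gen l.1)^-1.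

Definition linv (l : bool * bool) := (l.1, ~~ l.2).

(* A generator moves the complement of one of its two paddles onto the other
   one; for this to be exact one paddle is closed and the other one open. *)
Definition paddle (l : bool * bool) : set H :=
  [set x | if l.2 then la <= height l.1 x else height l.1 x < - la].

Definition fundamental : set H := [set x | forall l, ~ paddle l x].

Definition wact (w : seq (bool * bool)) x : H := foldr (fun l => act (letter l)) x w.

Definition reduced (w : seq (bool * bool)) := sorted (fun l l' => l' != linv l) w.

Lemma letter_linv l x : act (letter l) (act (letter (linv l)) x) = x.
Proof.
have g0 i := special_gt0 special_G0 (G0_gen i).
by case: l => i [] /=; rewrite /letter /= ?actV ?actKV.
Qed.

Lemma height_letter l x :
  height l.1 (act (letter l) x) = height l.1 x + (if l.2 then 2 * la else - (2 * la)).
Proof.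
case: l => i [] /=; rewrite /letter /=.
  by rewrite (height_dil (chart_gen i x)) addrC.
have e := chart_gen i (act (gen i)^-1 x).
rewrite actKV in e; last exact: (special_gt0 special_G0 (G0_gen i)).
by rewrite [in RHS](height_dil e); lra.
Qed.

Lemma paddle_letter l x : ~ paddle (linv l) x -> paddle l (act (letter l) x).
Proof.
rewrite /paddle /= height_letter; case: l => i [] /= => [/negP|/negP]; rewrite -?leNgt -?ltNge; lra.
Qed.

(** By [not_far] the paddles of one generator do not meet those of the other. *)
Lemma paddle_inj l l' x : paddle l x -> paddle l' x -> l = l'.
Proof.
have far (m : bool * bool) : paddle m x -> la <= `|height m.1 x|.
  rewrite /paddle /= ler_normr; case: m.2 => [->//|h]; apply/orP; right; lra.
move=> p p'; have [e|e] := eqVneq l.1 l'.1; last first.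
  have := far _ p'; have -> : l'.1 = ~~ l.1 by case: (l.1) (l'.1) e => [] [].
  by move=> /(not_far (far _ p)).
move: e p p'; case: l l' => i b [j b'] /= <-; rewrite /paddle /=.
by case: b b' => [] [] //= h1 h2; exfalso; move: la0; lra.
Qed.

(** Ping-pong: the first letter of a reduced word decides where the word sends
    the fundamental domain. *)
Lemma paddle_wact l w x : reduced (l :: w) -> fundamental x -> paddle l (wact (l :: w) x).
Proof.
elim: w l => [|l' w IH] l; first by move=> _ Fx; exact: paddle_letter.
rewrite /reduced /= => /andP[ll' rw] Fx; apply: paddle_letter => p.
by have := paddle_inj p (IH _ rw Fx) => e; rewrite -e eqxx in ll'.
Qed.

Lemma reduce_word w : exists2 w', reduced w' & wact w' =1 wact w.
Proof.
elim: w => [|l w [w' rw' e]]; first by exists [::].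
case: w' rw' e => [|l' w'] rw' e; first by exists [:: l] => // x /=; rewrite -e.
have [ll'|ll'] := eqVneq l' (linv l); last first.
  by exists (l :: l' :: w') => [|x]; [rewrite /reduced /= ll'|rewrite /= -e].
exists w'; first by move: rw'; rewrite /reduced /=; exact: path_sorted.
by move=> x; rewrite /= -e /= ll' letter_linv.
Qed.

Lemma G0_word g : G0 g -> exists w, forall x, act g x = wact w x.
Proof.
have [[G1 GM GV] _] := special_G0; have gt := special_gt0 special_G0.
have wcat w w' x : wact (w ++ w') x = wact w (wact w' x) by rewrite /wact foldr_cat.
have winv w x : wact (rev (map linv w)) (wact w x) = x.
  elim: w x => //= l w IH x; rewrite rev_cons -cats1 wcat /=.
  have -> : l = linv (linv l) by rewrite /linv /= negbK -surjective_pairing.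
  by rewrite [linv (linv (linv l))](_ : _ = linv l) ?letter_linv// /linv /= negbK.
have : G0 `<=` [set g | G0 g /\ exists w, forall x, act g x = wact w x].
  apply: group_generated_min; last first.
    move=> _ [->|->]; split; first by apply: group_generated_sub; left.
        by exists [:: (true, true)].
      by apply: group_generated_sub; right.
    by exists [:: (false, false)] => x /=; rewrite /letter /= invrK.
  split => [|h k [Gh [w wE]] [Gk [w' w'E]]|h [Gh [w wE]]].
  by split => //; exists [::] => x; rewrite act1.
  split; first exact: GM.
    by exists (w ++ w') => x; rewrite act_mul ?gt// wcat wE w'E.
  split; first exact: GV.
  exists (rev (map linv w)) => x.
  by rewrite -{2}[x](actKV (g := h)) ?gt// wE winv.
by move=> + Gg => /(_ _ Gg) [].
Qed.

(** Ping-pong excludes all reduced words but the empty one. *)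
Lemma fundamental_unique g x : G0 g -> fundamental x -> fundamental (act g x) ->
  forall y, act g y = y.
Proof.
move=> /G0_word [w wE] Fx; rewrite wE; have [w' rw' e] := reduce_word w; rewrite -e.
case: w' rw' e => [|l w'] rw' e; first by move=> _ y; rewrite wE -e.
by move=> /(_ l); case; exact: paddle_wact.
Qed.

(** A power of [gen i] brings [x] between the paddles of [gen i], and the collar
    does not meet the paddles of the other generator. *)
Lemma collar_fundamental i x : collar i width x -> exists2 g, G0 g &
  fundamental (act g x) /\ exists n : int,
    forall y, act (chart i) (act g y) = dil (2 * la * n%:~R) (act (chart i) y).
Proof.
move=> Vx; pose n : int := - Num.floor ((height i x + la) / (2 * la)).
have [g Gg gE] := chart_power i n; exists g => //; split; last by exists n.
have la2 : 0 < 2 * la by rewrite mulr_gt0.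
have hE := height_dil (gE x).
have /andP[n1 n2] := floor_itv ((height i x + la) / (2 * la)).
move: n1 n2; rewrite ler_pdivlMr// ltr_pdivrMr// intrD.
rewrite -[Num.floor _]opprK -/n mulrNz => n1 n2.
have hi : - la <= height i (act g x) < la by rewrite hE; apply/andP; split; lra.
have V' : collar i width (act g x) by rewrite /collar /= gE ctn_dil.
have := collar_near V'; rewrite ltr_norml => hj.
move=> [j b]; rewrite /paddle /=.
have [->|ji] := eqVneq j i; first by case: b; apply/negP; rewrite -?ltNge -?leNgt; move: hi; lra.
have -> : j = ~~ i by case: (i) (j) ji => [] [].
by case: b; apply/negP; rewrite -?ltNge -?leNgt; move: hj; lra.
Qed.

(** Both points are moved into the fundamental domain by powers of [gen i] and
    [gen j]; there they must coincide. *)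
Lemma collar_meet i j g x : G0 g -> collar i width x -> collar j width (act g x) ->
  exists h k, [/\ G0 h, G0 k, forall y, act k (act g y) = act h y &
  exists n m : int,
   (forall y, act (chart i) (act h y) = dil (2 * la * n%:~R) (act (chart i) y)) /\
   (forall y, act (chart j) (act k y) = dil (2 * la * m%:~R) (act (chart j) y))].
Proof.
have [[G1 GM GV] _] := special_G0; have gt := special_gt0 special_G0.
move=> Gg Vx Vy.
have [h Gh [Fx [n nE]]] := collar_fundamental Vx.
have [k Gk [Fy [m mE]]] := collar_fundamental Vy.
exists h, k; split => //; last by exists n, m.
have G : G0 (k * g * h^-1) by exact: (GM _ _ (GM _ _ Gk Gg) (GV _ Gh)).
have E z : act (k * g * h^-1) (act h z) = act k (act g z).
  by rewrite !act_mul ?gt ?actV ?gt//; [exact: GM|exact: GV].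
have U := fundamental_unique G Fx; rewrite E in U.
by move=> y; rewrite -E (U Fy).
Qed.

Lemma collar_precise i g x : G0 g -> collar i width x -> collar i width (act g x) ->
  exists n : int, forall y,
    act (chart i) (act g y) = dil (2 * la * n%:~R) (act (chart i) y).
Proof.
move=> Gg Vx Vy; have [h [k [_ _ e [n [m [nE mE]]]]]] := collar_meet Gg Vx Vy.
exists (n - m) => y; have := mE (act g y).
rewrite e nE => /(congr1 (dil (2 * la * (- m)%:~R))).
rewrite !dilD mulrNz mulrN addNr dil0 => <-; congr dil; rewrite intrD mulrNz; ring.
Qed.

Lemma collars_apart i g x : G0 g -> collar i width x -> collar (~~ i) width (act g x) -> False.
Proof.
move=> Gg Vx Vy; have [h [k [_ _ e [n [m [nE mE]]]]]] := collar_meet Gg Vx Vy.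
have V1 : collar i width (act h x) by rewrite /collar /= nE ctn_dil.
have V2 : collar (~~ i) width (act h x) by rewrite -e /collar /= mE ctn_dil.
by case: i V1 V2 {Vx Vy nE mE} => /= V1 V2; [exact: collarsI V1 V2|exact: collarsI V2 V1].
Qed.

End PingPong.

(** * Sectors of the half plane *)

Section Sectors.
Context {R : realType}.
Local Notation H := (half_plane (R := R)).

Lemma ctn_pt (k a : R) : ctn (hpt (k * expR a) (expR a)) = k.
Proof. by rewrite /ctn hre_pt ?expR_gt0// him_pt ?expR_gt0// mulfK// gt_eqF// expR_gt0. Qed.

Lemma sector_point (u : H) : u = hpt (ctn u * expR (ln (him u))) (expR (ln (him u))).
Proof.
have y0 := him_gt0 u; rewrite lnK//; apply: half_plane_eq.
  by rewrite hre_pt// /ctn divfK// gt_eqF.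
by rewrite him_pt.
Qed.

Lemma polar_eq (u v : H) : ctn u = ctn v -> hmod u = hmod v -> u = v.
Proof.
rewrite !hmodE => cuv; rewrite -cuv => /mulIf iuv.
have {}iuv : him u = him v.
  by rewrite iuv// gt_eqF// sqrtr_gt0 ltr_pwDl// sqr_ge0.
by rewrite (sector_point u) (sector_point v) cuv iuv.
Qed.

Lemma continuous_polar (T : topologicalType) (k a : T -> R) t :
  {for t, continuous k} -> {for t, continuous a} ->
  {for t, continuous (fun t => hpt (k t * expR (a t)) (expR (a t)))}.
Proof.
move=> ck ca; have ce : {for t, continuous (fun t => expR (a t))}.
  by apply: contcomp => //; exact: continuous_expR.
by apply: continuous_pt => [s||//]; [exact: expR_gt0|exact: contM].
Qed.

Lemma continuous_ctn : continuous (@ctn R).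
Proof.
move=> u; apply: contM; first exact: continuous_hre.
by apply: contV; [exact: continuous_him|rewrite gt_eqF// him_gt0].
Qed.

(** A sector is the union of its rays, which all cross its part of height 1. *)
Lemma sector_connected (J : interval R) : connected [set u : H | ctn u \in J].
Proof.
have [[k0 Jk0]|J0] := pselect (exists k, k \in J); last first.
  rewrite (_ : [set _ | _] = set0); first exact: connected0.
  by apply/seteqP; split => // u Ju; apply: J0; exists (ctn u).
pose ray k := [set hpt (k * expR a) (expR a) | a in [set: R]] : set H.
pose seg := [set hpt (k * expR 0) (expR 0) | k in [set` J]] : set H.
have cray k : connected (ray k).
  apply: connected_continuous_connected; first by apply/connected_intervalP.
  by apply: continuous_subspaceT => a; apply: continuous_polar; [exact: cst_continuous|].
have cseg : connected seg.
  apply: connected_continuous_connected; first by apply/connected_intervalP/interval_is_interval.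
  by apply: continuous_subspaceT => a; apply: continuous_polar; [|exact: cst_continuous].
rewrite (_ : [set _ | _] = \bigcup_(k in [set` J]) (seg `|` ray k)).
  apply: bigcup_connected; first by exists (hpt (k0 * expR 0) (expR 0)) => k Jk; left; exists k0.
  move=> k Jk; apply: connectedU => //.
  by exists (hpt (k * expR 0) (expR 0)); split; [exists k|exists 0].
apply/seteqP; split => [u Ju|u [k Jk [[k' Jk' <-]|[a _ <-]]]] /=; rewrite ?ctn_pt//.
by exists (ctn u) => //; right; exists (ln (him u)) => //; rewrite -sector_point.
Qed.

Lemma half_plane_connected : connected [set: H].
Proof.
rewrite (_ : setT = [set u : H | ctn u \in `]-oo, +oo[]); first exact: sector_connected.
by apply/seteqP; split => // u _ /=; rewrite in_itv.
Qed.

(** With [p], [q] the real and [y], [z] the imaginary parts, the hypotheses give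
    [(b - a) * z <= (p - q) - b * (y - z)] and
    [(b - a) * y <= (p - q) - a * (y - z)]. The bound is the product of the two
    inequalities that Cauchy and Schwarz deduce from them. *)
Lemma sector_gap (a b : R) (u v : H) : a < b -> b <= ctn u -> ctn v <= a ->
  (b - a) ^+ 2 / (1 + a ^+ 2 + b ^+ 2) <= hdist u v.
Proof.
move=> ab; have u0 := him_gt0 u; have v0 := him_gt0 v.
rewrite ler_pdivlMr// ler_pdivrMr// /hdist => hu hv.
have D0 : 0 < 1 + a ^+ 2 + b ^+ 2 by rewrite ltr_pwDl ?sqr_ge0// ltr_pwDl ?sqr_ge0.
rewrite ler_pdivrMr// mulrAC ler_pdivlMr ?mulr_gt0//.
move: (hre u) (him u) (hre v) (him v) u0 v0 hu hv D0 => p y q z y0 z0 hu hv D0.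
set Q := (p - q) ^+ 2 + (y - z) ^+ 2; set r := b - a.
have r0 : 0 < r by rewrite subr_gt0.
have [rz0 ry0] : 0 <= r * z /\ 0 <= r * y by split; rewrite mulr_ge0 ?ltW.
have Q0 : 0 <= Q by rewrite addr_ge0 ?sqr_ge0.
have hz : (r * z) ^+ 2 <= (1 + b ^+ 2) * Q.
  have h : r * z <= (p - q) - b * (y - z) by rewrite /r; lra.
  apply: (@le_trans _ _ (((p - q) - b * (y - z)) ^+ 2)).
    by rewrite ler_sqr ?nnegrE// (le_trans rz0 h).
  by rewrite -subr_ge0 (_ : _ - _ = (b * (p - q) + (y - z)) ^+ 2) ?sqr_ge0// /Q; ring.
have hy : (r * y) ^+ 2 <= (1 + a ^+ 2) * Q.
  have h : r * y <= (p - q) - a * (y - z) by rewrite /r; lra.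
  apply: (@le_trans _ _ (((p - q) - a * (y - z)) ^+ 2)).
    by rewrite ler_sqr ?nnegrE// (le_trans ry0 h).
  by rewrite -subr_ge0 (_ : _ - _ = (a * (p - q) + (y - z)) ^+ 2) ?sqr_ge0// /Q; ring.
have L0 : 0 <= r ^+ 2 * (y * z) by rewrite mulr_ge0 ?sqr_ge0// mulr_ge0 ?ltW.
have R0 : 0 <= Q * (1 + a ^+ 2 + b ^+ 2) by rewrite mulr_ge0// ltW.
rewrite -ler_sqr ?nnegrE//.
have -> : (r ^+ 2 * (y * z)) ^+ 2 = (r * y) ^+ 2 * (r * z) ^+ 2 by ring.
apply: (@le_trans _ _ ((1 + a ^+ 2) * Q * ((1 + b ^+ 2) * Q))).
  by apply: ler_pM; rewrite ?sqr_ge0.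
rewrite -subr_ge0 (_ : _ - _ = (a ^+ 2 + b ^+ 2 + (a ^+ 2) ^+ 2 + (b ^+ 2) ^+ 2 + (a * b) ^+ 2) * Q ^+ 2).
  by apply: mulr_ge0; rewrite ?sqr_ge0// !addr_ge0 ?sqr_ge0.
by ring.
Qed.

End Sectors.

(** * Ping-pong for the group of the punctured torus *)

Section FullGroup.
Context {R : realType}.
Local Notation H := (half_plane (R := R)).
Variables la tau : R.
Hypothesis la0 : 0 < la.
Implicit Types (x : H) (i e : bool) (f h : H -> H).
Local Notation G0 := (groupG0 la).
Local Notation GG := (groupG la tau).
Local Notation width := (collar_width la).
Local Notation ch := (chart la).

Lemma special_G : special_group GG.
Proof.
apply: special_group_generated => g [Gg|->]; last exact: det_T.
exact: (special_G0 la).2.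
Qed.

Lemma G0_sub_G : G0 `<=` GG.
Proof. by move=> g Gg; apply: group_generated_sub; left. Qed.

(** [T] in both directions, indexed so that [glue i] carries the axis of
    [gen (~~ i)] to that of [gen i]. *)
Definition glue i : 'M[R]_2 := if i then matT la tau else (matT la tau)^-1.

Lemma G_glue i : GG (glue i).
Proof.
have [[_ _ GV] _] := special_G; have GT : GG (matT la tau).
  by apply: group_generated_sub; right.
by case: i => //=; exact: GV.
Qed.

Lemma det_glue i : 0 < \det (glue i).
Proof. by apply: (special_gt0 special_G); exact: G_glue. Qed.

Lemma glueK i x : act (glue (~~ i)) (act (glue i) x) = x.
Proof. by case: i => /=; rewrite ?actV ?actKV ?det_T ?ltr01. Qed.

Lemma ctn_glue i x : ctn (act (ch i) (act (glue i) x)) = - ctn (act (ch (~~ i)) x).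
Proof.
case: i => /=; first exact: ctn_Mz_T.
have := ctn_Mz_T tau la0 (act (glue false) x); rewrite (glueK false) => ->.
by rewrite opprK.
Qed.

(* The sides of the two axes are half open so that each glueing of a side onto
   the complement of the other one is exact. *)
Definition beyond i : set H :=
  [set x | if i then ctn (act (ch i) x) < 0 else ctn (act (ch i) x) <= 0].

Lemma beyond_collar i x : beyond i x -> collar la i width x.
Proof.
have w0 := collar_width_gt0 la0.
by case: i => h; [exact: lt_trans h w0|exact: le_lt_trans h w0].
Qed.

Lemma beyond_glue i x : ~ beyond (~~ i) x -> beyond i (act (glue i) x).
Proof.
rewrite /beyond /= ctn_glue; case: i => /= /negP; first by rewrite -ltNge oppr_lt0.
by rewrite -leNgt oppr_le0.
Qed.

(** The lift of the convex core of [X0], with one of the two boundary geodesics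
    removed so that [groupG]-equivalent points are [groupG0]-equivalent. *)
Definition core : set H := [set x | forall g, G0 g -> forall i, ~ beyond i (act g x)].

(** Crossing the axis of [gen i] near it leads to the collar of the other end,
    on the side of the core. Precise invariance of that collar then keeps all
    translates away from both ends. *)
Lemma core_flip i x : beyond i x -> - width < ctn (act (ch i) x) ->
  core (act (glue (~~ i)) x).
Proof.
move=> bx wx g Gg j bj.
have cE : ctn (act (ch (~~ i)) (act (glue (~~ i)) x)) = - ctn (act (ch i) x).
  by rewrite ctn_glue negbK.
have V : collar la (~~ i) width (act (glue (~~ i)) x).
  by rewrite /collar /= cE; lra.
have [ji|ji] := eqVneq j (~~ i); last first.
  have {}ji : j = ~~ ~~ i by case: (i) (j) ji => [] [].
  by apply: (collars_apart la0 Gg V); rewrite -ji; exact: beyond_collar.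
subst j; have [n nE] := collar_precise la0 Gg V (beyond_collar bj).
move: bj; rewrite /beyond /= nE ctn_dil cE; move: bx; rewrite /beyond /=.
by case: (i) => /= h1 h2; lra.
Qed.

Definition stab i g := exists n : int,
  forall y, act (ch i) (act g y) = dil (2 * la * n%:~R) (act (ch i) y).

(** The maps [glue e \o g1 \o glue e2 \o ...] given by words, with [gk] in
    [groupG0], in which no factor can be cancelled by means of [glue_stab]. *)
Inductive crossing : bool -> (H -> H) -> Prop :=
| crossing_base e g : G0 g -> crossing e (act (glue e) \o act g)
| crossing_same e g h : G0 g -> crossing e h -> crossing e (act (glue e) \o act g \o h)
| crossing_opp e g h : G0 g -> ~ stab (~~ e) g -> crossing (~~ e) h ->
    crossing e (act (glue e) \o act g \o h).

Definition normal_form f := (exists2 g, G0 g & f = act g) \/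
  exists g e h, [/\ G0 g, crossing e h & f = act g \o h].

(** Ping-pong for the HNN extension: after an inner factor [glue (~~ e)] the
    point is in [beyond (~~ e)], and an element outside the stabilizer moves it
    off this half plane, because the collars are precisely invariant. *)
Lemma crossing_beyond e h x : crossing e h -> core x -> beyond e (h x).
Proof.
move=> N Dx; elim: N => {e h} [e g Gg|e g h Gg _ IH|e g h Gg ng _ IH] /=; apply: beyond_glue.
  exact: Dx.
move=> b; apply: (collars_apart la0 Gg (beyond_collar IH)); exact: beyond_collar.
move=> b; apply: ng; exact: (collar_precise la0 Gg (beyond_collar IH) (beyond_collar b)).
Qed.

Lemma crossing_inv e h : crossing e h -> exists2 r, normal_form r & h = act (glue e) \o r.
Proof.
case => {e h} [e g Gg|e g h Gg N|e g h Gg ng N].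
by exists (act g) => //; left; exists g.
by exists (act g \o h) => //; right; exists g, e, h.
by exists (act g \o h) => //; right; exists g, (~~ e), h.
Qed.

Lemma normal_G0 k f : G0 k -> normal_form f -> normal_form (act k \o f).
Proof.
have [[_ GM _] _] := special_G0 la; have gt := special_gt0 (special_G0 la).
have cE g : G0 k -> G0 g -> act k \o act g = act (k * g).
  by move=> Gk Gg; apply: funext => x; rewrite act_mul ?gt.
move=> Gk [[g Gg ->]|[g [e [h [Gg N ->]]]]].
  by left; exists (k * g); [exact: GM|rewrite cE].
right; exists (k * g), e, h; split => //; first exact: GM.
by rewrite -cE.
Qed.

Lemma hmod_glue i x :
  hmod (act (ch i) (act (glue i) x)) = expR (- tau) / hmod (act (ch (~~ i)) x).
Proof.
have hT y : hmod (act (ch true) (act (glue true) y)) = expR (- tau) / hmod (act (ch false) y).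
  by rewrite /= act_Mz_T// hmod_neg_inv// expR_gt0.
case: i => /=; first exact: hT.
have := hT (act (glue false) x); rewrite (glueK false) /= => ->.
by rewrite invfM invrK mulrA mulfV ?mul1r// gt_eqF// expR_gt0.
Qed.

Lemma glue_dil e a x y : act (ch (~~ e)) y = dil a (act (ch (~~ e)) x) ->
  act (ch e) (act (glue e) y) = dil (- a) (act (ch e) (act (glue e) x)).
Proof.
move=> yE; apply: polar_eq; first by rewrite ctn_dil !ctn_glue yE ctn_dil.
by rewrite hmod_dil !hmod_glue yE hmod_dil (expRN a) invfM mulrCA.
Qed.

(** In the charts, elements of the stabilizers are dilations, which
    [u |-> - k / u] conjugates to their inverses. *)
Lemma glue_stab e g : G0 g -> stab (~~ e) g ->
  exists2 k, G0 k & act (glue e) \o act g = act k \o act (glue e).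
Proof.
move=> Gg [n nE]; have [k Gk kE] := chart_power la0 e (- n); exists k => //.
apply: funext => x /=; apply: (act_inj (det_chart la0 e)).
by rewrite kE (glue_dil (nE x)) mulrNz mulrN.
Qed.

Lemma normal_glue e f : normal_form f -> normal_form (act (glue e) \o f).
Proof.
have [[G1 GM _] _] := special_G0 la.
move=> [[g Gg ->]|[g [e' [h [Gg N ->]]]]].
  right; exists 1, e, (act (glue e) \o act g); split => //; first exact: crossing_base.
  by apply: funext => x /=; rewrite act1.
have one f' : f' = act 1 \o f' by apply: funext => x /=; rewrite act1.
have [ee|ee] := eqVneq e' e.
  by subst e'; right; exists 1, e, (act (glue e) \o act g \o h); split => //; exact: crossing_same.
have {}ee : e' = ~~ e by case: (e) (e') ee => [] [].
subst e'; have [st|st] := pselect (stab (~~ e) g); last first.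
  by right; exists 1, e, (act (glue e) \o act g \o h); split => //; exact: crossing_opp.
have [k Gk kE] := glue_stab Gg st; have [r Nr ->] := crossing_inv N.
have -> : act (glue e) \o (act g \o (act (glue (~~ e)) \o r)) = act k \o r.
  apply: funext => x /=.
  have /= -> := congr1 (fun f => f (act (glue (~~ e)) (r x))) kE.
  by rewrite -{1}[e]negbK glueK.
exact: normal_G0.
Qed.

Lemma G_normal g : GG g -> normal_form (act g).
Proof.
have [[G1 GM GV] _] := special_G0 la; have gt := special_gt0 special_G.
pose N : set 'M[R]_2 := [set g | GG g /\ forall f, normal_form f ->
  normal_form (act g \o f) /\ normal_form (act g^-1 \o f)].
have [[GG1 GGM GGV] _] := special_G.
have NN : GG `<=` N.
  apply: group_generated_min.
    split => [|k l [Gk Nk] [Gl Nl]|k [Gk Nk]].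
        split => // f Nf; rewrite invr1 (_ : act 1 \o f = f)//.
        by apply: funext => x /=; rewrite act1.
      split; first exact: GGM.
      move=> f Nf; have uk : k \is a GRing.unit by rewrite unitmxE unitfE gt_eqF ?gt.
      have ul : l \is a GRing.unit by rewrite unitmxE unitfE gt_eqF ?gt.
      rewrite invrM// (_ : act (k * l) \o f = act k \o (act l \o f)); last first.
        by apply: funext => x /=; rewrite act_mul ?gt.
      rewrite (_ : act (l^-1 * k^-1) \o f = act l^-1 \o (act k^-1 \o f)); last first.
        by apply: funext => x /=; rewrite act_mul ?gt//; exact: GGV.
      by split; [exact/(Nk _ _).1/(Nl _ _).1|exact/(Nl _ _).2/(Nk _ _).2].
    by split; [exact: GGV|move=> f Nf; rewrite invrK; split; [exact: (Nk f Nf).2|exact: (Nk f Nf).1]].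
  move=> k [Gk|->].
    split; [exact: G0_sub_G|move=> f Nf; split; apply: normal_G0 => //; exact: GV].
  split; [exact: (G_glue true)|move=> f Nf; split].
    exact: (normal_glue true).
  exact: (normal_glue false).
move=> /NN [_ /(_ id)].
case; first by left; exists 1 => //; apply: funext => x; rewrite act1.
by [].
Qed.

Lemma core_precise g x : GG g -> core x -> core (act g x) ->
  exists2 k, G0 k & act g x = act k x.
Proof.
have [[G1 GM GV] _] := special_G0 la; have gt := special_gt0 (special_G0 la).
move=> /G_normal [[k Gk ->]|[k [e [h [Gk N ->]]]]] Dx; first by exists k.
move=> /(_ k^-1 (GV _ Gk) e); rewrite /= actV ?gt//.
by case; exact: crossing_beyond.
Qed.

(** A point at a small distance from the core is in the core or has just
    crossed one of the axes, in which case the glueing map brings it back. The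
    gap between sectors makes the distance uniform. *)
Lemma core_nearby : exists2 d, 0 < d & forall x y, core x -> hdist x y < d ->
  exists2 g, GG g & core (act g y).
Proof.
have w0 := collar_width_gt0 la0; have gt0 := special_gt0 (special_G0 la).
have [[_ GGM _] _] := special_G; have gt := special_gt0 special_G.
have Nw : - width < 0 by rewrite oppr_lt0.
exists ((0 - - width) ^+ 2 / (1 + (- width) ^+ 2 + 0 ^+ 2)).
  rewrite divr_gt0 ?exprn_gt0//; first lra.
  by rewrite ltr_pwDl ?sqr_ge0// ltr_pwDl ?sqr_ge0.
move=> x y Dx xy; have [Dy|] := pselect (core y).
  by exists 1; [case: special_G => -[]|rewrite act1].
move=> /existsNP [g /not_implyP [Gg /existsNP [i /contrapT bi]]].
have gx : ~ beyond i (act g x) by exact: Dx.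
have c0 : 0 <= ctn (act (ch i) (act g x)).
  by move: gx; rewrite /beyond /=; case: (i) => /negP; [rewrite -leNgt|rewrite -ltNge => /ltW].
have [cw|cw] := ltP (- width) (ctn (act (ch i) (act g y))).
  exists (glue (~~ i) * g); first by apply: GGM; [exact: G_glue|exact: G0_sub_G].
  by rewrite act_mul; [exact: core_flip|exact: det_glue|exact: gt0].
have := sector_gap Nw c0 cw; rewrite hdist_act; last exact: det_chart.
by rewrite hdist_act ?leNgt ?xy//; exact: gt0.
Qed.

(** By [core_nearby] the translates of the core form an open set with open
    complement, and the half plane is connected. *)
Lemma core_cover x : exists2 g, GG g & core (act g x).
Proof.
have [[GG1 GGM GGV] _] := special_G; have gt := special_gt0 special_G.
have [d d0 dP] := core_nearby.
pose Y := [set x | exists2 g, GG g & core (act g x)].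
have near_Y y z : Y y -> hdist y z < d -> Y z.
  move=> [g Gg Dy] yz; have [|k Gk Dk] := dP _ (act g z) Dy; first by rewrite hdist_act ?gt.
  by exists (k * g); [exact: GGM|rewrite act_mul ?gt].
have oY : open Y.
  by rewrite openE => y Yy; apply: filterS (nbhs_hdist y d0) => z; exact: near_Y.
have cY : closed Y.
  rewrite -openC openE => y Yy; apply: filterS (nbhs_hdist y d0) => z yz Yz.
  by apply: Yy; apply: near_Y Yz _; rewrite hdistC.
have Y0 : Y !=set0.
  have w0 := collar_width_gt0 la0.
  (* A point slightly beyond an axis is brought into the core by crossing it. *)
  pose u : H := hpt (- (width / 2) * expR 0) (expR 0).
  have [cu Mu] : ctn u = - (width / 2) /\ act (ch true) (act (ch true)^-1 u) = u.
    by rewrite ctn_pt actKV// det_chart.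
  exists (act (ch true)^-1 u); exists (glue false); first exact: G_glue.
  by apply: (core_flip (i := true)); rewrite /beyond /= ?Mu ?cu; lra.
have YT : Y = setT.
  by apply: half_plane_connected => //; exists Y => //; rewrite setTI.
by have : Y x by rewrite YT.
Qed.

End FullGroup.

(** * The ends of the punctured cylinder *)

Section Components.
Context {X : topologicalType}.
Implicit Types A K : set X.

(** The component of a point of [K] is connected and [K] is clopen in it. *)
Lemma clopen_component A K C D : K !=set0 -> connected K -> open C -> K = A `&` C ->
  closed D -> K = A `&` D -> is_component A K.
Proof.
move=> [x Kx] cK oC KC cD KD; have KA : K `<=` A by rewrite KC => y [].
exists x; first exact: KA.
apply/seteqP; split; first exact: connected_component_max.
have cc : connected (connected_component A x) := @component_connected _ A x.
have sub := @connected_component_sub _ A x.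
have xx : connected_component A x x by apply: connected_component_refl; exact: KA.
have := cc (connected_component A x `&` K) => <-; first by move=> y [].
  by exists x.
  exists C => //; rewrite {1}KC; apply/seteqP; split => y [? H]; split => //; first by case: H.
  by split => //; exact: sub.
exists D => //; rewrite {1}KD; apply/seteqP; split => y [? H]; split => //; first by case: H.
by split => //; exact: sub.
Qed.

End Components.

Section Descent.
Context {R : realType}.
Local Notation H := (half_plane (R := R)).
Variables (G : set 'M[R]_2) (V : set H).
Hypothesis sG : special_group G.

Definition descend (Z : Type) (d : Z) (F : H -> Z) (p : orbit_surface G) : Z :=
  if pselect (exists x, V x /\ orb_proj G x = p) is left e then F (projT1 (cid e)) else d.

Lemma descend_proj (Z : Type) (d : Z) (F : H -> Z) :
  (forall g x, G g -> V x -> V (act g x) -> F (act g x) = F x) ->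
  forall x, V x -> descend d F (orb_proj G x) = F x.
Proof.
move=> FG x Vx; rewrite /descend; case: pselect => [e|]; last by case; exists x.
case: (cid e) => /= y [Vy /(orb_projP sG) [g Gg xE]].
by rewrite xE FG// -xE.
Qed.

Lemma continuous_descend (Z : topologicalType) (d : Z) (F : H -> Z) : open V ->
  (forall g x, G g -> V x -> V (act g x) -> F (act g x) = F x) ->
  forall x, V x -> {for x, continuous F} ->
  {for orb_proj G x, continuous (descend d F)}.
Proof.
move=> oV FG x Vx cF; apply: continuous_at_orb_proj => // U.
rewrite /= descend_proj// => /cF nU.
change (nbhs x ((descend d F \o orb_proj G) @^-1` U)).
have n : nbhs x (V `&` F @^-1` U) by apply: filterI => //; exact: open_nbhs_nbhs.
by apply: filterS n => y [Vy Uy]; rewrite /preimage /= descend_proj.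
Qed.

End Descent.

Section Ends.
Context {R : realType}.
Local Notation H := (half_plane (R := R)).
Variable la : R.
Hypothesis la0 : 0 < la.
Implicit Types (x : H) (i : bool) (P Q : set R).
Local Notation G0 := (groupG0 la).
Local Notation X0 := (surfaceX0 la).
Local Notation pi0 := (orb_proj (groupG0 la) : H -> surfaceX0 la).
Local Notation width := (collar_width la).
Local Notation ch := (chart la).

Definition cot i x : R := ctn (act (ch i) x).

Lemma continuous_cot i : continuous (cot i).
Proof.
move=> x; apply: (continuous_comp (f := act (ch i)) (g := @ctn R)); first by apply: continuous_act; exact: det_chart.
exact: continuous_ctn.
Qed.

Definition band i P : set X0 := pi0 @` [set x | P (cot i x)].

(** For such [P] the bands lie in the images of the embedded collars. *)
Definition narrow P := forall k, P k -> k < width.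

(** By precise invariance the cotangent is a function on the image of the
    collar. *)
Lemma bandP i P x : narrow P -> collar la i width x -> band i P (pi0 x) -> P (cot i x).
Proof.
move=> nP Vx [y Py /(orb_projP (special_G0 la)) [g Gg xE]]; subst x.
have [n nE] := collar_precise la0 Gg (nP _ Py) Vx.
by rewrite /cot nE ctn_dil.
Qed.

Lemma bandI i P Q : narrow P -> narrow Q -> band i P `&` band i Q = band i (P `&` Q).
Proof.
move=> nP nQ; apply/seteqP; split => [_ [[x Px <-] Qx]|_ [x [Px Qx] <-]]; last by split; exists x.
exists x => //; split => //; exact: (bandP nQ (nP _ Px) Qx).
Qed.

Lemma bandU i P Q : band i (P `|` Q) = band i P `|` band i Q.
Proof.
apply/seteqP; split => [_ [x [Px|Qx] <-]|_ [[x Px <-]|[x Qx <-]]]; try by [left; exists x|right; exists x].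
  by exists x => //; left.
by exists x => //; right.
Qed.

Lemma band_sub i P Q : P `<=` Q -> band i P `<=` band i Q.
Proof. by move=> PQ _ [x Px <-]; exists x => //; exact: PQ. Qed.

Lemma bandD i P Q : narrow P -> narrow Q -> band i P `\` band i Q = band i (P `\` Q).
Proof.
move=> nP nQ; apply/seteqP; split => [_ [[x Px <-] nQx]|_ [x [Px Qx] <-]].
  by exists x => //; split => // Qx; apply: nQx; exists x.
split; first by exists x.
by move=> /(bandP nQ (nP _ Px)).
Qed.

Lemma band_apart i P Q : narrow P -> narrow Q -> band i P `&` band (~~ i) Q = set0.
Proof.
move=> nP nQ; apply/seteqP; split => // _ [[x Px <-] [y Qy]] /esym.
move=> /(orb_projP (special_G0 la)) [g Gg yE]; subst y.
exact: (collars_apart la0 Gg (nP _ Px) (nQ _ Qy)).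
Qed.

Lemma band_point i k : exists x, cot i x = k.
Proof.
exists (act (ch i)^-1 (hpt (k * expR 0) (expR 0))).
by rewrite /cot actKV ?det_chart// ctn_pt.
Qed.

Lemma band_neq0 i P k : P k -> band i P !=set0.
Proof. by have [x <-] := band_point i k; exists (pi0 x); exists x. Qed.

Lemma open_band i P : open P -> open (band i P).
Proof.
move=> oP; apply: (open_orb_proj (special_G0 la)).
by apply: open_comp => // x _; exact: continuous_cot.
Qed.

Lemma connected_band i (J : interval R) : connected (band i [set` J]).
Proof.
apply: connected_continuous_connected; last by apply: continuous_subspaceT; exact: continuous_orb_proj.
rewrite (_ : [set x | _] = act (ch i)^-1 @` [set u : H | ctn u \in J]).
  apply: connected_continuous_connected; first exact: sector_connected.
  apply: continuous_subspaceT; apply: continuous_act; rewrite det_inv invr_gt0; exact: det_chart.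
apply/seteqP; split => [x Jx|_ [u Ju <-]]; last by rewrite /= /cot actKV// det_chart.
by exists (act (ch i) x) => //; rewrite actV// det_chart.
Qed.

(** A point outside all lifts of the collar keeps a definite hyperbolic distance
    from the lifts of a thinner one; inside the collar the cotangent
    decides. *)
Lemma closed_band i a : a < width -> closed (band i [set k | k <= a]).
Proof.
move=> aw; have na : narrow [set k | k <= a] by move=> k /= ka; exact: le_lt_trans ka aw.
have gt := special_gt0 (special_G0 la).
rewrite -openC; apply/openE_orbit; rewrite openE => x xb.
have [[g [Gg Vg]]|far] := pselect (exists g, G0 g /\ collar la i width (act g x)).
  have ag : a < cot i (act g x).
    by rewrite ltNge; apply/negP => h; apply: xb; exists (act g x) => //; rewrite orb_proj_act//; exact: special_G0.
  have n1 : nbhs x (act g @^-1` (cot i @^-1` `]a, width[)).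
    apply: continuous_act; first exact: gt.
    apply: continuous_cot; apply: open_nbhs_nbhs; split; first exact: interval_open.
    by rewrite /= in_itv /= ag.
  apply: filterS n1 => y /=; rewrite in_itv /= => /andP[ay yw].
  rewrite -(orb_proj_act (special_G0 la) y Gg) => /(bandP na yw) /=.
  by rewrite leNgt ay.
have d0 : 0 < (width - a) ^+ 2 / (1 + a ^+ 2 + width ^+ 2).
  rewrite divr_gt0 ?exprn_gt0// ?subr_gt0// ltr_pwDl ?sqr_ge0// ltr_pwDl ?sqr_ge0//.
apply: filterS (nbhs_hdist x d0) => y /= xy [z za /esym/(orb_projP (special_G0 la)) [g Gg zE]].
subst z; have wx : width <= cot i (act g x).
  by rewrite leNgt; apply/negP => h; apply: far; exists g.
have := sector_gap aw wx za; rewrite hdist_act; last exact: det_chart.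
by rewrite hdist_act ?leNgt ?xy//; exact: gt.
Qed.

Lemma closed_band_itv i a b : a <= b -> b < width -> closed (band i [set` `[a, b]]).
Proof.
move=> ab bw.
have nb : narrow [set k | k <= b] by move=> k /= kb; exact: le_lt_trans kb bw.
have na : narrow [set k | k < a] by move=> k /= ka; exact: lt_trans ka (le_lt_trans ab bw).
rewrite (_ : [set` _] = [set k | k <= b] `\` [set k | k < a]).
  rewrite -bandD// setDE; apply: closedI; first exact: closed_band.
  exact/open_closedC/open_band/open_lt.
apply/seteqP; split => k /=; rewrite in_itv /=; first by move=> /andP[? ?]; split => //; apply/negP; rewrite -leNgt.
by move=> [-> /negP]; rewrite -leNgt => ->.
Qed.

Definition lift i : H -> R[i] := if i then zlift la else wlift la.

Lemma liftE i x : lift i x = annulus_cover la (act (ch i) x).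
Proof. by case: i => /=; [exact: zliftE|exact: wliftE]. Qed.

Lemma lift_compat i g x : G0 g -> collar la i width x -> collar la i width (act g x) ->
  lift i (act g x) = lift i x.
Proof.
move=> Gg Vx Vy; have [n nE] := collar_precise la0 Gg Vx Vy.
by rewrite !liftE nE annulus_cover_dil.
Qed.

Lemma lift_inj i x y : lift i x = lift i y -> pi0 x = pi0 y.
Proof.
rewrite !liftE => /(annulus_cover_inj la0) [n nE].
have [g Gg gE] := chart_power la0 i n.
have -> : x = act g y by apply: (act_inj (det_chart la0 i)); rewrite nE gE.
by rewrite orb_proj_act//; exact: special_G0.
Qed.

Definition coord i : X0 -> R[i] := descend (collar la i width) 0 (lift i).

Lemma coordE i x : collar la i width x -> coord i (pi0 x) = lift i x.
Proof.
by move=> Vx; apply: (descend_proj (special_G0 la)) => // g y Gg; exact: lift_compat.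
Qed.

Lemma open_collar i a : open (collar la i a).
Proof.
rewrite (_ : collar la i a = cot i @^-1` [set k | k < a])//.
by apply: open_comp => [x _|]; [exact: continuous_cot|exact: open_lt].
Qed.

Lemma lifted_collar_sub i a : exists2 r, critical_modulus la < r &
  lifted_collar (lift i) r `<=` collar la i a.
Proof.
have [r cr rP] := annulus_cover_collar la0 a; exists r => // x.
by rewrite /lifted_collar /= liftE => /rP.
Qed.

Lemma connected_collar i a : connected (collar la i a).
Proof.
rewrite (_ : collar la i a = act (ch i)^-1 @` [set u : H | ctn u \in `]-oo, a[]).
  apply: connected_continuous_connected; first exact: sector_connected.
  apply: continuous_subspaceT; apply: continuous_act; rewrite det_inv invr_gt0; exact: det_chart.
apply/seteqP; split => [x Jx|_ [u Ju <-]]; last first.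
  by move: Ju; rewrite /= /collar /= in_itv /= actKV// det_chart.
by exists (act (ch i) x); rewrite /= ?in_itv// actV// det_chart.
Qed.

Lemma coord_end_coordinate i : end_coordinate (lift i) (collar la i width) (coord i).
Proof.
split.
- exact: open_collar.
- exact: connected_collar.
- exact: lifted_collar_sub.
- by move=> x Vx; exact: coordE.
- move=> _ [_ [x Vx <-] <-]; rewrite -[projX0 _ _]/(pi0 x) coordE// liftE.
  exact: annulus_cover_range.
move=> _ _ [x Vx <-] [y Vy <-]; rewrite -[projX0 _ x]/(pi0 x) -[projX0 _ y]/(pi0 y).
by rewrite !coordE//; exact: lift_inj.
Qed.

End Ends.

(** * The annuli of the plumbing *)

Section PolarComplex.
Context {R : realType}.

Lemma cabs_gt0 (z : R[i]) : z != 0 -> 0 < cabs z.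
Proof. by rewrite -normr_gt0 /cabs ltcE => /andP[_]. Qed.

Lemma cabsE (z : R[i]) : cabs z = Num.sqrt (complex.Re z ^+ 2 + complex.Im z ^+ 2).
Proof. by rewrite /cabs normc_def. Qed.

Lemma sqr_cabs (z : R[i]) : cabs z ^+ 2 = complex.Re z ^+ 2 + complex.Im z ^+ 2.
Proof. by rewrite cabsE sqr_sqrtr// addr_ge0 ?sqr_ge0. Qed.

Lemma cabsM (z w : R[i]) : cabs (z * w) = cabs z * cabs w.
Proof. by rewrite /cabs normrM; rewrite [`|z|]normc_def [`|w|]normc_def; simpc. Qed.

(* The argument is an arccosine, up to sign. *)
Lemma polar_ex (z : R[i]) : exists a, z = (cabs z)%:C * cis a.
Proof.
have [->|z0] := eqVneq z 0; first by exists 0; rewrite /cabs normr0 /= mul0r.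
have n0 := cabs_gt0 z0; have := sqr_cabs z; move: (cabs z) n0 => n n0.
case: z z0 => x y _ /= nE; have n1 := lt0r_neq0 n0.
have x1 : -1 <= x / n <= 1.
  rewrite ler_pdivlMr// ler_pdivrMr// mul1r mulN1r -ler_norml.
  by rewrite -ler_sqr ?nnegrE ?(ltW n0)// real_normK ?num_real// nE lerDl sqr_ge0.
have ca : cos (acos (x / n)) = x / n by apply: acosK; rewrite in_itv.
have sa : sin (acos (x / n)) = `|y| / n.
  rewrite sin_acos// (_ : 1 - (x / n) ^+ 2 = (y / n) ^+ 2).
    by rewrite sqrtr_sqr normrM normfV (gtr0_norm n0).
  by rewrite !expr_div_n nE; field; rewrite -nE sqrf_eq0.
have [y0|y0] := leP 0 y.
  exists (acos (x / n)); rewrite /cis ca sa ger0_norm//.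
  by simpc; rewrite !(mulrC n) !divfK.
exists (- acos (x / n)); rewrite /cis cosN sinN ca sa ltr0_norm// mulNr opprK.
by simpc; rewrite !(mulrC n) !divfK.
Qed.

Definition cang (z : R[i]) : R := projT1 (cid (polar_ex z)).

Lemma cangP z : z = (cabs z)%:C * cis (cang z).
Proof. by rewrite /cang; case: cid. Qed.

(** The argument of [z / z0] is added to that of [z0]; it is small for [z] near
    [z0], which makes this determination continuous at [z0]. *)
Definition cang_near (z0 z : R[i]) : R := cang z0 +
  atan ((complex.Im z * complex.Re z0 - complex.Re z * complex.Im z0) /
        (complex.Re z * complex.Re z0 + complex.Im z * complex.Im z0)).

Lemma continuous_cabs : continuous (@cabs R).
Proof.
move=> z; have cr : {for z, continuous (@complex.Re R : R[i] -> R)} by exact: continuous_Re.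
have ci : {for z, continuous (@complex.Im R : R[i] -> R)} by exact: continuous_Im.
have c2 := contD (contM cr cr) (contM ci ci).
rewrite (_ : @cabs R = fun z => Num.sqrt (complex.Re z * complex.Re z + complex.Im z * complex.Im z)).
  exact: (contcomp c2 (@sqrt_continuous R _)).
by apply: funext => w; rewrite cabsE !expr2.
Qed.

Lemma continuous_dot (z0 : R[i]) : continuous (fun z : R[i] =>
  complex.Re z * complex.Re z0 + complex.Im z * complex.Im z0).
Proof.
move=> z; have cr : {for z, continuous (@complex.Re R : R[i] -> R)} by exact: continuous_Re.
have ci : {for z, continuous (@complex.Im R : R[i] -> R)} by exact: continuous_Im.
have ck (a : R) : {for z, continuous (fun _ : R[i] => a)} by exact: cst_continuous.
exact: (contD (contM cr (ck _)) (contM ci (ck _))).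
Qed.

Lemma cang_near_continuous (z0 : R[i]) : z0 != 0 -> {for z0, continuous (cang_near z0)}.
Proof.
move=> z00; have cr : {for z0, continuous (@complex.Re R : R[i] -> R)} by exact: continuous_Re.
have ci : {for z0, continuous (@complex.Im R : R[i] -> R)} by exact: continuous_Im.
have ck (a : R) : {for z0, continuous (fun _ : R[i] => a)} by exact: cst_continuous.
have dn : complex.Re z0 * complex.Re z0 + complex.Im z0 * complex.Im z0 != 0.
  by rewrite -!expr2 -sqr_cabs sqrf_eq0 gt_eqF// cabs_gt0.
have cn := contB (contM ci (ck (complex.Re z0))) (contM cr (ck (complex.Im z0))).
have cq := contM cn (contV (@continuous_dot z0 z0) dn).
exact: (contD (ck (cang z0)) (contcomp cq (@continuous_atan R _))).
Qed.

Lemma cang_nearP (z0 : R[i]) : z0 != 0 ->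
  \forall z \near z0, z = (cabs z)%:C * cis (cang_near z0 z).
Proof.
move=> z00; have n0 := cabs_gt0 z00.
have dot0 : 0 < complex.Re z0 * complex.Re z0 + complex.Im z0 * complex.Im z0.
  by rewrite -!expr2 -sqr_cabs exprn_gt0.
have := continuous_dist (@continuous_dot z0 z0) dot0; apply: filterS => z /=.
rewrite ltr_norml => /andP[+ _]; set D := complex.Re z0 * _ + _ => zD.
have {}zD : 0 < complex.Re (z * z0^*).
  have -> : complex.Re (z * z0^*) = complex.Re z * complex.Re z0 + complex.Im z * complex.Im z0.
    by case: (z) (z0) => ? ? [? ?] /=; rewrite mulrN opprK.
  lra.
have := cis_atan zD; rewrite -cabsE.
have -> : complex.Im (z * z0^*) / complex.Re (z * z0^*) =
   (complex.Im z * complex.Re z0 - complex.Re z * complex.Im z0) /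
        (complex.Re z * complex.Re z0 + complex.Im z * complex.Im z0).
  by case: (z) (z0) => a b [c d] /=; congr (_ / _); ring.
rewrite cabsM (_ : cabs z0^* = cabs z0); last first.
  by rewrite !cabsE; case: (z0) => a b /=; rewrite sqrrN.
rewrite /cang_near cisD; set C := cis (atan _); set C0 := cis (cang z0).
have e0 : z0 = (cabs z0)%:C * C0 by exact: cangP.
have e1 : z0^* * z0 = (cabs z0 ^+ 2)%:C.
  by rewrite sqr_cabs; case: (z0) => a b; simpc; congr (_ +i* _); ring.
move=> /(congr1 (fun w => w * z0)); rewrite -mulrA e1 rmorphXn rmorphM /= => e2.
have n1 : (cabs z0)%:C != 0 :> R[i] by rewrite eq_complex /= eqxx andbT gt_eqF.
apply: (mulIf (x := (cabs z0)%:C ^+ 2)); first by rewrite sqrf_eq0.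
have -> : z * (cabs z0)%:C ^+ 2 = (cabs z)%:C * (cabs z0)%:C * C * ((cabs z0)%:C * C0).
  by rewrite -e0.
by ring.
Qed.

End PolarComplex.

Section EndAnnuli.
Context {R : realType}.
Local Notation H := (half_plane (R := R)).
Variable la : R.
Hypothesis la0 : 0 < la.
Implicit Types (x : H) (i : bool) (P Q : set R).
Local Notation G0 := (groupG0 la).
Local Notation X0 := (surfaceX0 la).
Local Notation pi0 := (orb_proj (groupG0 la) : H -> surfaceX0 la).
Local Notation width := (collar_width la).
Local Notation ch := (chart la).
Local Notation band0 := (@band R la).
Local Notation eps := (collar_width la / 2).

(* The annuli are centred at the boundary geodesics [cot = 0] and have half of
   the width of the collars, so that their closures are still embedded. *)
Definition annulus i : set X0 := band0 i [set` `]- eps, eps[].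
Definition outer i : set X0 := band0 i [set - eps].
Definition inner i : set X0 := band0 i [set eps].
Definition tail i : set X0 := band0 i [set` `]-oo, - eps[].

(** The point of the ray [ctn = k] with logarithmic height [a], in the chart
    [i]. *)
Definition section i (k a : R) : H := act (ch i)^-1 (hpt (k * expR a) (expR a)).

Lemma chart_section i k a : act (ch i) (section i k a) = hpt (k * expR a) (expR a).
Proof. by rewrite /section actKV// det_chart. Qed.

Lemma cot_section i k a : cot la i (section i k a) = k.
Proof. by rewrite /cot chart_section ctn_pt. Qed.

Lemma section_surj i x : x = section i (cot la i x) (ln (him (act (ch i) x))).
Proof. by rewrite /section /cot -sector_point actV// det_chart. Qed.

Lemma continuous_section (T : topologicalType) i (k a : T -> R) t :
  {for t, continuous k} -> {for t, continuous a} ->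
  {for t, continuous (fun t => section i (k t) (a t))}.
Proof.
move=> ck ca; apply: (continuous_comp (g := act (ch i)^-1)); first exact: continuous_polar.
by apply: continuous_act; rewrite det_inv invr_gt0; exact: det_chart.
Qed.

(** Going once around the end. *)
Lemma section_period i k a (n : int) :
  pi0 (section i k (a + 2 * la * n%:~R)) = pi0 (section i k a).
Proof.
have [g Gg gE] := chart_power la0 i n.
have -> : section i k (a + 2 * la * n%:~R) = act g (section i k a).
  apply: (act_inj (det_chart la0 i)); rewrite gE !chart_section.
  by apply: half_plane_eq; rewrite ?hre_dil ?him_dil ?hre_pt ?him_pt ?expR_gt0// expRD; ring.
by apply: orb_proj_act => //; exact: special_G0.
Qed.

Lemma eps_gt0 : 0 < eps.
Proof. by rewrite divr_gt0// collar_width_gt0. Qed.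

Lemma eps_lt : eps < width.
Proof. by have := collar_width_gt0 la0; lra. Qed.

Lemma narrow_le P k : P `<=` [set h | h <= k] -> k <= eps -> narrow la P.
Proof. by move=> Pk ke h /Pk /= hk; have := eps_lt; lra. Qed.

Lemma narrow_annulus : narrow la [set` `]- eps, eps[].
Proof. by apply: (narrow_le (k := eps)) => // k /=; rewrite in_itv /= => /andP[_ /ltW]. Qed.

Lemma narrow_closed : narrow la [set` `[- eps, eps]].
Proof. by apply: (narrow_le (k := eps)) => // k /=; rewrite in_itv /= => /andP[_]. Qed.

Lemma narrow_tail : narrow la [set` `]-oo, - eps[].
Proof.
have e0 := eps_gt0; apply: (narrow_le (k := eps)) => // k /=.
by rewrite in_itv /= => h; lra.
Qed.

Lemma narrow1 k : k <= eps -> narrow la [set k].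
Proof. by move=> ke; apply: (narrow_le (k := eps)) => // h /= ->. Qed.

Lemma closure_annulus i : closure (annulus i) = band0 i [set` `[- eps, eps]].
Proof.
have e0 := eps_gt0; have ew := eps_lt; apply/seteqP; split.
  have <- : closure (band0 i [set` `[- eps, eps]]) = band0 i [set` `[- eps, eps]].
    by apply/esym/closure_id/closed_band_itv => //; lra.
  by apply/closureS/band_sub => k /=; rewrite !in_itv /= => /andP[/ltW -> /ltW ->].
move=> _ [x + <-] U; rewrite /= in_itv /= => kx.
rewrite [x](section_surj i); move: kx; set k := cot la i x; set a := ln _ => kx nU.
have cf : {for 1, continuous (fun s : R => pi0 (section i (k * s) a))}.
  apply: (continuous_comp (g := pi0)); last exact: continuous_orb_proj.
  apply: continuous_section; last exact: contcst.
  by apply: contM; [exact: contcst|].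
have n1 : nbhs (1 : R) [set s | U (pi0 (section i (k * s) a))].
  by apply: cf; rewrite mulr1.
have : \forall s \near (1 : R)^'-, U (pi0 (section i (k * s) a)) /\ 0 < s < 1.
  near=> s; split; last by apply/andP; split; near: s; [exact: nbhs_left_gt|exact: nbhs_left_lt].
  by near: s; apply: filterS n1 => r Ur _.
move=> /filter_ex [s [Us /andP[s0 s1]]].
exists (pi0 (section i (k * s) a)); split => //; exists (section i (k * s) a) => //=.
by rewrite cot_section in_itv /=; move: kx => /andP[k1 k2]; apply/andP; split; nra.
Unshelve. all: by end_near. Qed.

Lemma boundary_annulus i : boundary (annulus i) = outer i `|` inner i.
Proof.
have oA : open (annulus i) by apply: open_band => //; exact: interval_open.
have e0 := eps_gt0.
rewrite /boundary closure_annulus (interior_id _).1// bandD//; last 2 first.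
  exact: narrow_closed.
  exact: narrow_annulus.
rewrite /outer /inner -bandU; congr band; apply/seteqP; split => k /=; rewrite !in_itv /=.
  move=> [/andP[k1 k2] /negP]; rewrite negb_and -!leNgt => /orP[h|h]; [left|right];
    by apply/eqP; rewrite eq_le ?k1 ?k2 h.
by case=> ->; rewrite !lexx ?ltxx ?andbF /=; split => //; rewrite ?andbT; lra.
Qed.

Lemma outer_inner i : outer i `&` inner i = set0.
Proof.
have e0 := eps_gt0; rewrite bandI//; [|by apply: narrow1; lra|exact: narrow1].
rewrite (_ : _ `&` _ = set0); first by rewrite /band0 image_set0.
by apply/seteqP; split => // k /= [-> ]; lra.
Qed.

Lemma set1_itv (k : R) : [set k] = [set` `[k, k]].
Proof. by rewrite set_itv1. Qed.

Lemma component_outer i : is_component (outer i `|` inner i) (outer i).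
Proof.
have e0 := eps_gt0; have ew := eps_lt.
have cO : closed (outer i) by rewrite /outer set1_itv; apply: closed_band_itv => //; lra.
have cI : closed (inner i) by rewrite /inner set1_itv; apply: closed_band_itv => //; lra.
apply: (@clopen_component _ _ _ (~` inner i) (outer i)).
- exact: (band_neq0 la0 i (k := - eps)).
- by rewrite /outer set1_itv; exact: connected_band.
- exact: closed_openC.
- apply/seteqP; split => [p Op|p [[//|//] ]]; split; first by left.
  by move=> Ip; have : (outer i `&` inner i) p by []; rewrite outer_inner.
- exact: cO.
by apply/seteqP; split => [p Op|p [_ //]]; split => //; left.
Qed.

Lemma component_inner i : is_component (outer i `|` inner i) (inner i).
Proof.
have e0 := eps_gt0; have ew := eps_lt.
have cO : closed (outer i) by rewrite /outer set1_itv; apply: closed_band_itv => //; lra.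
have cI : closed (inner i) by rewrite /inner set1_itv; apply: closed_band_itv => //; lra.
apply: (@clopen_component _ _ _ (~` outer i) (inner i)).
- exact: (band_neq0 la0 i (k := eps)).
- by rewrite /inner set1_itv; exact: connected_band.
- exact: closed_openC.
- apply/seteqP; split => [p Op|p [[//|//] ]]; split; first by right.
  by move=> Ip; have : (outer i `&` inner i) p by []; rewrite outer_inner.
- exact: cI.
by apply/seteqP; split => [p Op|p [_ //]]; split => //; right.
Qed.

Lemma component_tail i : is_component (~` outer i) (tail i).
Proof.
have e0 := eps_gt0; have ew := eps_lt; have nT := narrow_tail.
have n1 : narrow la [set - eps] by apply: narrow1; lra.
have dTO : tail i `&` outer i = set0.
  rewrite bandI// (_ : _ `&` _ = set0); first by rewrite /band0 image_set0.
  by apply/seteqP; split => // k /= [kt ke]; move: kt; rewrite ke in_itv /= ltxx.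
apply: (@clopen_component _ _ _ (tail i) (band0 i [set k | k <= - eps])).
- by apply: (band_neq0 la0 i (k := - eps - 1)); rewrite /= in_itv /=; lra.
- exact: connected_band.
- by apply: open_band => //; exact: interval_open.
- apply/seteqP; split => [p Tp|p [] //]; split => // Op.
  by have : (tail i `&` outer i) p by []; rewrite dTO.
- by apply: closed_band => //; lra.
have E : [set k | k <= - eps] = [set` `]-oo, - eps[] `|` [set - eps].
  apply/seteqP; split => k /=; rewrite in_itv /= le_eqVlt.
    by move=> /orP[/eqP|]; [right|left].
  by move=> [->|->]; rewrite ?eqxx ?orbT.
rewrite E bandU; apply/seteqP; split => [p Tp|p [nO [//|//]]].
by split; [move=> Op; have : (tail i `&` outer i) p by []; rewrite dTO|left].
Qed.

End EndAnnuli.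

Lemma continuous_near_eq (T Z : topologicalType) (f g : T -> Z) t :
  (\forall s \near t, f s = g s) -> {for t, continuous f} -> {for t, continuous g}.
Proof.
move=> fg cf U; rewrite -(nbhs_singleton fg) => nU.
have n : nbhs t (f @^-1` U) by exact: cf.
by change (nbhs t (g @^-1` U)); apply: filterS2 fg n => s /= -> .
Qed.

Section Attaching.
Context {R : realType}.
Local Notation H := (half_plane (R := R)).
Variable la : R.
Hypothesis la0 : 0 < la.
Implicit Types (x : H) (i : bool) (P Q : set R).
Local Notation G0 := (groupG0 la).
Local Notation X0 := (surfaceX0 la).
Local Notation pi0 := (orb_proj (groupG0 la) : H -> surfaceX0 la).
Local Notation width := (collar_width la).
Local Notation ch := (chart la).
Local Notation band0 := (@band R la).
Local Notation eps := (collar_width la / 2).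
Local Notation annulus0 := (@annulus R la).
Local Notation section0 := (@section R la).

(** A coordinate that maps the collar annulus homeomorphically to a round one.
    It is not holomorphic: the modulus is affine in the cotangent, with value 3 / 2
    on the geodesic, and the argument records the logarithmic height. *)
Definition ring_lift i x : R[i] :=
  (3 / 2 + cot la i x / width)%:C * cis (pi / la * ln (him (act (ch i) x))).

Lemma ring_lift_compat i g x : G0 g -> collar la i width x -> collar la i width (act g x) ->
  ring_lift i (act g x) = ring_lift i x.
Proof.
move=> Gg Vx Vy; have [n nE] := collar_precise la0 Gg Vx Vy.
rewrite /ring_lift /cot nE ctn_dil him_dil lnM ?posrE ?expR_gt0 ?him_gt0// expRK.
rewrite -[in RHS](cis_2pi_int n); congr (_ * cis _).
by move: (pi) (ln _) => p l; field; rewrite gt_eqF.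
Qed.

Lemma continuous_ring_lift i : continuous (ring_lift i).
Proof.
move=> x; rewrite (_ : ring_lift i = fun y => ((3 / 2 + cot la i y / width) * cos (pi / la * ln (him (act (ch i) y))))
   +i* ((3 / 2 + cot la i y / width) * sin (pi / la * ln (him (act (ch i) y))))); last first.
  by apply: funext => y; rewrite /ring_lift /cis; simpc.
have ck (a : R) : {for x, continuous (fun _ : H => a)} by exact: cst_continuous.
have cm : {for x, continuous (fun y => 3 / 2 + cot la i y / width)}.
  exact: (contD (ck _) (contM (@continuous_cot _ _ la0 i x) (ck _))).
have ch' : {for x, continuous (fun y => pi / la * ln (him (act (ch i) y)))}.
  apply: contM; first exact: ck.
  apply: contcomp; last by apply: continuous_ln; exact: him_gt0.
  apply: (continuous_comp (f := act (ch i)) (g := @him R)); last exact: continuous_him.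
  by apply: continuous_act; exact: det_chart.
exact: (continuous_complex (contM cm (contcomp ch' (@continuous_cos R _)))
  (contM cm (contcomp ch' (@continuous_sin R _)))).
Qed.

Definition ring_of_annulus i : X0 -> R[i] := descend (collar la i width) 0 (ring_lift i).

Definition annulus_of_ring i (z : R[i]) : X0 :=
  pi0 (section0 i (width * (cabs z - 3 / 2)) (la / pi * cang z)).

Lemma annulus_of_ring_arg i (z : R[i]) a : z != 0 -> z = (cabs z)%:C * cis a ->
  annulus_of_ring i z = pi0 (section0 i (width * (cabs z - 3 / 2)) (la / pi * a)).
Proof.
move=> z0 zE; have n1 : (cabs z)%:C != 0 :> R[i].
  by rewrite eq_complex /= eqxx andbT gt_eqF// cabs_gt0.
have /(mulfI n1)/cis_inj [n aE] : (cabs z)%:C * cis (cang z) = (cabs z)%:C * cis a.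
  by rewrite -zE -cangP.
rewrite /annulus_of_ring aE (_ : _ * (a + _) = la / pi * a + 2 * la * n%:~R).
  exact: section_period.
by have := pi_gt0 R; move: pi => p p0; field; rewrite gt_eqF.
Qed.

Lemma continuous_annulus_of_ring i (z : R[i]) : z != 0 -> {for z, continuous (annulus_of_ring i)}.
Proof.
move=> z0; pose h (w : R[i]) :=
  pi0 (section0 i (width * (cabs w - 3 / 2)) (la / pi * cang_near z w)).
have ck (a : R) : {for z, continuous (fun _ : R[i] => a)} by exact: cst_continuous.
have c1 := contM (ck width) (contB (@continuous_cabs R z) (ck (3 / 2))).
have c2 := contM (ck (la / pi)) (cang_near_continuous z0).
apply: (@continuous_near_eq _ _ h); last first.
  have c3 := continuous_section (i := i) la0 c1 c2.
  exact: (continuous_comp c3 (@continuous_orb_proj _ G0 _)).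
have near0 : \forall w \near z, w != 0.
  have := continuous_dist (@continuous_cabs R z) (cabs_gt0 z0).
  apply: filterS => w /=; rewrite ltr_norml => /andP[wz _].
  by apply: contraTneq wz => ->; rewrite /cabs normr0 /= sub0r ltxx.
apply: filterS2 near0 (cang_nearP z0) => w w0 wE.
by rewrite (annulus_of_ring_arg i w0 wE).
Qed.

Lemma annulus_homeomorphism i :
  homeomorphism_on (round_annulus 1 2) (annulus0 i) (annulus_of_ring i).
Proof.
have w0 := collar_width_gt0 la0; have nA := @narrow_annulus _ _ la0.
have ringE x : collar la i width x -> ring_of_annulus i (pi0 x) = ring_lift i x.
  by move=> Vx; apply: (descend_proj (special_G0 la)) => // g y Gg; exact: ring_lift_compat.
have band_w x : x \in [set x | cot la i x \in `]- eps, eps[] -> 0 <= 3 / 2 + cot la i x / width.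
  rewrite inE /= in_itv /= => /andP[h _].
  have -> : 3 / 2 + cot la i x / width = (3 / 2 * width + cot la i x) / width by field; rewrite gt_eqF.
  by rewrite divr_ge0 ?(ltW w0)//; lra.
exists (ring_of_annulus i); split.
- move=> _ [z /andP[z1 z2] <-]; exists (section0 i (width * (cabs z - 3 / 2)) (la / pi * cang z)) => //.
  by rewrite /= cot_section// in_itv /=; apply/andP; split; nra.
- move=> _ [_ [x Ax <-] <-]; rewrite ringE; last exact: (nA _ Ax).
  rewrite /round_annulus /= /ring_lift cabs_real_cis; last by apply: band_w; rewrite inE.
  move: Ax; rewrite /= in_itv /= => /andP[x1 x2].
  have -> : 3 / 2 + cot la i x / width = (3 / 2 * width + cot la i x) / width by field; rewrite gt_eqF.
  by apply/andP; split; [rewrite ltr_pdivlMr//; lra|rewrite ltr_pdivrMr//; lra].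
- move=> z /andP[z1 z2]; rewrite /annulus_of_ring ringE; last first.
    by rewrite /collar /= chart_section// ctn_pt; nra.
  rewrite /ring_lift cot_section// chart_section// him_pt ?expR_gt0// expRK.
  rewrite [RHS]cangP; congr (_%:C * cis _); first by field; rewrite gt_eqF.
  by have := pi_gt0 R; move: pi => p p0; field; rewrite !gt_eqF.
- move=> _ [x Ax <-]; rewrite ringE; last exact: (nA _ Ax).
  have x0 : 0 <= 3 / 2 + cot la i x / width by apply: band_w; rewrite inE.
  have x1 : 0 < 3 / 2 + cot la i x / width.
    have -> : 3 / 2 + cot la i x / width = (3 / 2 * width + cot la i x) / width by field; rewrite gt_eqF.
    by move: Ax; rewrite /= in_itv /= => /andP[h _]; rewrite divr_gt0//; lra.
  rewrite (@annulus_of_ring_arg _ _ (pi / la * ln (him (act (ch i) x)))); last 2 first.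
    apply/eqP => /(congr1 (@cabs R)); rewrite /ring_lift cabs_real_cis// => e.
    by move: x1; rewrite e /cabs normr0 /= ltxx.
    by rewrite {2}/ring_lift cabs_real_cis.
  have -> : width * (cabs (ring_lift i x) - 3 / 2) = cot la i x.
    by rewrite /ring_lift cabs_real_cis//; field; rewrite gt_eqF.
  have -> : la / pi * (pi / la * ln (him (act (ch i) x))) = ln (him (act (ch i) x)).
    by have := pi_gt0 R; move: (pi) (ln _) => p l p0; field; rewrite !gt_eqF.
  by rewrite -section_surj.
split; apply: continuous_in_subspaceT => z.
  rewrite inE => /andP[z1 _]; apply: continuous_annulus_of_ring.
  by apply: contraTneq z1 => ->; rewrite /cabs normr0 /= ltr10.
rewrite inE => -[x Ax <-]; apply: (continuous_descend (special_G0 la)).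
- exact: open_collar.
- by move=> g y Gg; exact: ring_lift_compat.
- exact: (nA _ Ax).
exact: continuous_ring_lift.
Qed.

(** The two curves agree, so that the homotopy is constant. *)
Lemma annulus_core_homotopic i : homotopic_to_end (lift la i) (annulus0 i).
Proof.
exists (annulus_of_ring i); split; first exact: annulus_homeomorphism.
exists (fun s => section0 i 0 (2 * la * s)), (expR (- (pi / la * (pi / 2 - atan 0)))).
have cc : continuous (fun s => section0 i 0 (2 * la * s)).
  move=> s; have ck (a : R) : {for s, continuous (fun _ : R => a)} by exact: cst_continuous.
  have ci : {for s, continuous (fun s : R => s)} by [].
  exact: (continuous_section (i := i) la0 (ck 0) (contM (ck (2 * la)) ci)).
have circ s : unit_circle s = cis (2 * pi * s) :> R[i].
  by rewrite /unit_circle /cexp /= expR0 mul1r.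
have mid s : annulus_of_ring i ((3 / 2)%:C * unit_circle s) = pi0 (section0 i 0 (2 * la * s)).
  have r0 : 0 <= 3 / 2 :> R by rewrite divr_ge0.
  rewrite circ (@annulus_of_ring_arg _ _ (2 * pi * s)); last 2 first.
    apply/eqP => /(congr1 (@cabs R)); rewrite cabs_real_cis// /cabs normr0 /= => e.
    by have : (3 / 2 : R) != 0 by []; rewrite e eqxx.
    by rewrite cabs_real_cis.
  rewrite cabs_real_cis// subrr mulr0 (_ : la / pi * (2 * pi * s) = 2 * la * s)//.
  by have := pi_gt0 R; move: pi => p p0; field; rewrite gt_eqF.
split; first exact: continuous_subspaceT.
  move=> s _; rewrite (liftE la0) chart_section// annulus_coverE// ctn_pt circ.
  rewrite hmodE ctn_pt him_pt ?expR_gt0// expr0n /= addr0 sqrtr1 mulr1 expRK.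
  congr (_ * cis _); by move: pi => p; field; rewrite gt_eqF.
exists (fun us => pi0 (section0 i 0 (2 * la * us.2))); split.
- apply: continuous_subspaceT => us.
  apply: (continuous_comp (f := fun us : R * R => section0 i 0 (2 * la * us.2)) (g := pi0));
    last exact: continuous_orb_proj.
  apply: (continuous_comp (f := snd) (g := fun s => section0 i 0 (2 * la * s))); first exact: cvg_snd.
  exact: cc.
- by move=> s _ /=; rewrite mid.
- by [].
by move=> u _ /=; rewrite mulr0 -(section_period la0 i 0 0 1) add0r.
Qed.

Lemma end_annulus_collar i : end_annulus (lift la i) (annulus0 i)
  (outer i) (inner i) (tail i).
Proof.
have e0 := eps_gt0 la0; have w0 := collar_width_gt0 la0.
split.
- by apply: open_band => //; exact: interval_open.
- exact: annulus_core_homotopic.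
- by rewrite boundary_annulus//; exact: component_outer.
- by rewrite boundary_annulus//; exact: component_inner.
- move=> e; have := outer_inner la0 i; rewrite -e setIid => o0.
  by have := band_neq0 la0 i (k := - eps) (erefl : [set - eps] (- eps)); rewrite -/(outer i) o0 => -[].
- exact: boundary_annulus.
- exact: component_tail.
- have [r cr rP] := lifted_collar_sub la0 i (- eps); exists r => //.
  move=> _ [x /rP xr <-]; exists x => //=; by rewrite in_itv /=.
rewrite bandI//; [|exact: narrow_tail|exact: narrow1].
rewrite (_ : _ `&` _ = set0); first by rewrite /band image_set0.
by apply/seteqP; split => // k /= [kt ke]; move: kt; rewrite ke in_itv /=; lra.
Qed.

End Attaching.

(** * The plumbing data *)

Section Plumbing.
Context {R : realType}.
Local Notation H := (half_plane (R := R)).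
Variables la tau : R.
Hypothesis la0 : 0 < la.
Implicit Types (x : H) (i : bool) (P Q : set R).
Local Notation G0 := (groupG0 la).
Local Notation X0 := (surfaceX0 la).
Local Notation pi0 := (orb_proj (groupG0 la) : H -> surfaceX0 la).
Local Notation width := (collar_width la).
Local Notation ch := (chart la).
Local Notation band0 := (@band R la).
Local Notation eps := (collar_width la / 2).
Local Notation glue := (glue la tau).
Local Notation annulus0 := (@annulus R la).
Local Notation outer0 := (@outer R la).
Local Notation inner0 := (@inner R la).

(** The attaching map [cross true] and its inverse. *)
Definition cross i : X0 -> X0 :=
  descend (collar la i width) (pi0 hi) (pi0 \o act (glue (~~ i))).

(** An element that maps a point of the collar to another one stabilizes the
    axis, and [glue_stab] applies to it. *)
Lemma cross_compat i g x : G0 g -> collar la i width x -> collar la i width (act g x) ->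
  (pi0 \o act (glue (~~ i))) (act g x) = (pi0 \o act (glue (~~ i))) x.
Proof.
move=> Gg Vx Vy; have st := collar_precise la0 Gg Vx Vy.
have [|k Gk kE] := glue_stab tau la0 (e := ~~ i) Gg; first by rewrite negbK.
rewrite /= (_ : act _ (act g x) = act k (act (glue (~~ i)) x)).
  by apply: orb_proj_act => //; exact: special_G0.
exact: (congr1 (fun f => f x) kE).
Qed.

Lemma crossE i x : collar la i width x -> cross i (pi0 x) = pi0 (act (glue (~~ i)) x).
Proof.
by move=> Vx; apply: (descend_proj (special_G0 la)) => // g y Gg; exact: cross_compat.
Qed.

Lemma continuous_cross i x : collar la i width x -> {for pi0 x, continuous (cross i)}.
Proof.
move=> Vx; apply: (continuous_descend (special_G0 la)) => //.
    exact: open_collar.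
  by move=> g y Gg; exact: cross_compat.
apply: (continuous_comp (f := act (glue (~~ i))) (g := pi0)).
  by apply: continuous_act; exact: det_glue.
exact: continuous_orb_proj.
Qed.

Lemma cot_glue i x : cot la (~~ i) (act (glue (~~ i)) x) = - cot la i x.
Proof. by rewrite /cot ctn_glue// negbK. Qed.

Lemma collar_glue i x : - width < cot la i x ->
  collar la (~~ i) width (act (glue (~~ i)) x).
Proof.
by move=> wx; have := cot_glue i x; rewrite /cot /collar /= => ->; rewrite ltrNl.
Qed.

Lemma cross_band i P : narrow la P ->
  cross i @` band0 i P = band0 (~~ i) [set - k | k in P].
Proof.
move=> nP; apply/seteqP; split => [_ [_ [x Px <-] <-]|_ [x [k Pk kE] <-]].
  rewrite crossE; last exact: (nP _ Px).
  by exists (act (glue (~~ i)) x) => //=; exists (cot la i x) => //; rewrite cot_glue.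
have cx : cot la i (act (glue i) x) = k.
  by have := cot_glue (~~ i) x; rewrite negbK -kE opprK.
exists (pi0 (act (glue i) x)); first by exists (act (glue i) x) => //=; rewrite cx.
rewrite crossE ?glueK//; by rewrite /collar /= -/(cot la i _) cx; exact: nP.
Qed.

Lemma cross_annulus i : cross i @` annulus0 i = annulus0 (~~ i).
Proof.
rewrite /annulus cross_band; last exact: narrow_annulus.
congr band; apply/seteqP; split => k /=.
  by move=> [h + <-]; rewrite !in_itv /= ltrNr opprK ltrNl andbC.
by move=> kA; exists (- k); rewrite ?opprK//; move: kA; rewrite !in_itv /= ltrNr opprK ltrNl andbC.
Qed.

Lemma crossK i x : cot la i x \in `]- eps, eps[ -> cross (~~ i) (cross i (pi0 x)) = pi0 x.
Proof.
move=> xA; have Vx : collar la i width x by exact: (narrow_annulus la0 xA).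
have w0 := collar_width_gt0 la0.
rewrite crossE// crossE; last first.
  by apply: collar_glue; move: xA; rewrite in_itv /= => /andP[? _]; lra.
by have := glueK tau la0 (~~ i) x => ->.
Qed.

Lemma cross_homeo i : homeomorphism_on (annulus0 i) (annulus0 (~~ i)) (cross i).
Proof.
have cc j : {within annulus0 j, continuous (cross j)}.
  apply: continuous_in_subspaceT => p; rewrite inE => -[x xA <-].
  by apply: continuous_cross; exact: (narrow_annulus la0 xA).
exists (cross (~~ i)); split => //.
- by rewrite cross_annulus.
- by rewrite cross_annulus negbK.
- by move=> _ [x xA <-]; exact: crossK.
by move=> _ [x xA <-]; have := crossK xA; rewrite negbK.
Qed.

(** In the half plane the map is locally a Moebius map. *)
Lemma cross_holomorphic i : holomorphic_on (annulus0 i) (cross i).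
Proof.
have oA : open (annulus0 i) by apply: open_band => //; exact: interval_open.
have cA : {within annulus0 i, continuous (cross i)} by have [? [_ _ _ _ []]] := cross_homeo i.
split => // V k /holo_orbit [oV dk]; apply/holo_orbit; split.
  apply: (continuous_inP (cross i) oA).1 => // p; rewrite inE => -[x xA <-].
  by apply: continuous_cross; exact: (narrow_annulus la0 xA).
move=> x [[y yA /esym/(orb_projP (special_G0 la)) [g Gg yE]] Vx]; subst y.
have g0 := special_gt0 (special_G0 la) Gg.
have Vy := narrow_annulus la0 yA.
have gT : 0 < \det (glue (~~ i) * g) by rewrite det_mulmx mulr_gt0// det_glue.
apply: (@derivable_near _ (((k \o pi0) \o act (glue (~~ i) * g)) \o hof)).
  have n : nbhs x (act g @^-1` collar la i width).
    by apply: continuous_act => //; apply: open_nbhs_nbhs; split => //; exact: open_collar.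
  apply: filterS (nbhs_hval n) => z Vz /=.
  by rewrite -(orb_proj_act (special_G0 la) (hof z) Gg) crossE// act_mul// det_glue.
apply: derivable_act => //; apply: dk.
by move: Vx; rewrite /= -(orb_proj_act (special_G0 la) x Gg) crossE// act_mul// det_glue.
Qed.

Definition plumbing_parameter : R[i] := (critical_modulus la)%:C * cis (pi / la * - tau).

Lemma cross_zw p : annulus0 true p -> coord true p * coord false (cross true p) = plumbing_parameter.
Proof.
move=> [x xA <-]; have Vx := narrow_annulus la0 xA.
have w0 := collar_width_gt0 la0.
rewrite crossE// !coordE//; last first.
  by apply: (@collar_glue true); move: xA; rewrite /= in_itv /= => /andP[? _]; lra.
have := zw_T tau la0 (act (glue false) x).
by have /= -> := glueK tau la0 false x.
Qed.

Lemma cross_closure : {within closure (annulus0 true), continuous (cross true)}.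
Proof.
rewrite closure_annulus//; apply: continuous_in_subspaceT => p; rewrite inE => -[x xA <-].
by apply: continuous_cross; exact: (narrow_closed la0 xA).
Qed.

Lemma cross_boundary : cross true @` outer0 true = inner0 false.
Proof.
rewrite /outer cross_band; last by apply: (narrow1 la0); have := eps_gt0 la0; lra.
by congr band; rewrite image_set1 opprK.
Qed.

Lemma annulus_sub i : annulus0 i `<=` projX0 la @` collar la i width.
Proof. by move=> _ [x xA <-]; exists x => //; exact: (narrow_annulus la0 xA). Qed.

Lemma collar_images_disjoint :
  (projX0 la @` collar la true width) `&` (projX0 la @` collar la false width) = set0.
Proof.
have nw : narrow la [set k | k < width] by [].
by have := band_apart la0 true nw nw.
Qed.

Definition collar_plumbing : plumbing la plumbing_parameter :=
  Plumbing (coord_end_coordinate la0 true) (coord_end_coordinate la0 false)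
    collar_images_disjoint (end_annulus_collar la0 true) (end_annulus_collar la0 false)
    (annulus_sub (i := true)) (annulus_sub (i := false))
    (cross_homeo true) (cross_holomorphic true) cross_closure cross_boundary cross_zw.

Lemma norm_plumbing_parameter : `|plumbing_parameter| = (expR (- (pi ^+ 2 / la)))%:C.
Proof.
have /(congr1 (real_complex R)) := cabs_real_cis (pi / la * - tau) (expR_ge0 (- (pi ^+ 2 / la))).
by rewrite /cabs RRe_real ?normr_real.
Qed.

End Plumbing.

(** * The plumbed surface is the punctured torus *)

Lemma continuous_into_subtype (T X : topologicalType) (A : set X) (f : T -> set_type A) t :
  {for t, continuous (set_val \o f)} -> {for t, continuous f}.
Proof.
move=> cf U; rewrite nbhsE /= => -[_ [[B oB <-] fB]] BU.
have n : nbhs t ((set_val \o f) @^-1` B) := cf B (open_nbhs_nbhs (conj oB fB)).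
by change (nbhs t (f @^-1` U)); apply: filterS n => s; exact: BU.
Qed.

Section Biholomorphism.
Context {R : realType}.
Local Notation H := (half_plane (R := R)).
Variables la tau : R.
Hypothesis la0 : 0 < la.
Implicit Types (x y : H) (i : bool).
Local Notation G0 := (groupG0 la).
Local Notation GG := (groupG la tau).
Local Notation X0 := (surfaceX0 la).
Local Notation torus := (punctured_torus la tau).
Local Notation pi0 := (orb_proj (groupG0 la) : H -> surfaceX0 la).
Local Notation piG := (orb_proj (groupG la tau) : H -> punctured_torus la tau).
Local Notation width := (collar_width la).
Local Notation ch := (chart la).
Local Notation eps := (collar_width la / 2).
Local Notation glue := (glue la tau).
Local Notation P := (collar_plumbing tau la0).
Local Notation trunc := (truncated_surface P).
Local Notation plumbed := (plumbed_surface P).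
Local Notation piP := (\pi_{eq_quot (glued_equiv P)} : trunc -> plumbed).

Let sG0 := special_G0 la.
Let sG := special_G tau la0.

Definition to_torus (p : X0) : torus := piG (projT1 (cid (orb_proj_surj p))).

Lemma to_torusE x : to_torus (pi0 x) = piG x.
Proof.
rewrite /to_torus; case: cid => y /= /(orb_projP sG0) [g Gg ->].
by rewrite orb_proj_act//; exact: G0_sub_G.
Qed.

Lemma continuous_to_torus : continuous to_torus.
Proof.
apply: continuous_orbit; rewrite (_ : to_torus \o orb_proj G0 = piG).
  exact: continuous_orb_proj.
by apply: funext => x /=; exact: to_torusE.
Qed.

Definition trunc_set : set X0 := ~` (beyond1 P `|` beyond2 P).

Lemma trunc_setP x : trunc_set (pi0 x) <->
  forall g i, G0 g -> - eps <= cot la i (act g x).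
Proof.
split=> [tx g i Gg|tx [[y yT]|[y yT]] /esym/(orb_projP sG0) [g Gg yE]].
  rewrite leNgt; apply/negP => h; apply: tx; rewrite -(orb_proj_act sG0 x Gg).
  by case: i h => h; [left|right]; exists (act g x); rewrite //= in_itv.
  by move: yT; rewrite /= in_itv /= yE ltNge tx.
by move: yT; rewrite /= in_itv /= yE ltNge tx.
Qed.

(* Away from the borders the structure of the truncated surface is that of
   [X0]. *)
Definition trunc_open : set X0 :=
  [set p | forall i, ~ band i [set k | k <= - eps] p].

Lemma open_trunc_open : open trunc_open.
Proof.
have e0 := eps_gt0 la0; have ew := eps_lt la0.
rewrite (_ : trunc_open = ~` band true [set k | k <= - eps] `&` ~` band false [set k | k <= - eps]).
  by apply: openI; apply: closed_openC; apply: closed_band => //; lra.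
apply/seteqP; split => [p pt|p [p1 p2]]; first by split; exact: pt.
by case.
Qed.

Lemma trunc_open_sub : trunc_open `<=` trunc_set°.
Proof.
have {1}-> : trunc_open = trunc_open° by apply/esym/interior_id/open_trunc_open.
apply: interiorS => p pt [Tp|Tp]; [apply: (pt true)|apply: (pt false)];
  by apply: band_sub Tp => k /=; rewrite in_itv /= => /ltW.
Qed.

Lemma core_trunc x : core la x -> trunc_open (pi0 x).
Proof.
have e0 := eps_gt0 la0.
move=> Dx i [y /= yk /esym/(orb_projP sG0) [g Gg yE]]; apply: (Dx g Gg i).
by move: yk; rewrite yE /cot /beyond /=; case: (i) => /= h; lra.
Qed.

Lemma core_trunc_set x : core la x -> trunc_set (pi0 x).
Proof. by move=> Dx; exact: (interior_subset (trunc_open_sub (core_trunc Dx))). Qed.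

Lemma trunc_set_ex : exists p, p \in trunc_set.
Proof.
have [g _ Dx] := core_cover tau la0 hi.
exists (pi0 (act g hi)); exact: (mem_set (core_trunc_set Dx)).
Qed.

Definition trunc0 : trunc := SigSub (projT2 (cid trunc_set_ex)).

Definition into_trunc (p : X0) : trunc := insubd trunc0 p.

Lemma into_truncK p : trunc_set p -> set_val (into_trunc p) = p.
Proof. by move=> tp; rewrite set_valE insubdK//; exact: mem_set. Qed.

Lemma trunc_lift (u : trunc) : exists2 x, trunc_set (pi0 x) & u = into_trunc (pi0 x).
Proof.
have [x xu] := orb_proj_surj (set_val u : X0); have tu : trunc_set (set_val u) by exact: set_valP.
exists x; first by rewrite xu.
by apply: val_inj; have := into_truncK tu; rewrite xu set_valE => ->.
Qed.

Lemma piP_eq (u v : trunc) : piP u = piP v <-> glued u v.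
Proof.
split => [/(introT (eqmodP (glued_equiv P) u v))//|uv].
exact: (elimT (eqmodP (glued_equiv P) u v)).
Qed.

(** If [z(x) w(y) = t] then [w(y)] is the coordinate of the image of [x] under
    [glue false], by [zw_T], and hence [y] is this image. *)
Lemma glued_to_torus (u v : trunc) : glued u v -> to_torus (set_val u) = to_torus (set_val v).
Proof.
move=> /asboolP; elim => {u v} [u v [[x Vx xu] [y Vy yv] zw]||u v _ ->|u w v _ -> _ ->]//.
rewrite -xu -yv -[projX0 la x]/(pi0 x) -[projX0 la y]/(pi0 y) !to_torusE.
move: zw; rewrite -xu -yv -[projX0 la x]/(pi0 x) -[projX0 la y]/(pi0 y) /=.
rewrite !coordE// => zw.
have zT : lift la true x * lift la false (act (glue false) x) = plumbing_parameter la tau.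
  have := zw_T tau la0 (act (glue false) x).
  by have /= -> := glueK tau la0 false x.
have z0 : lift la true x != 0 by rewrite (liftE la0) annulus_cover_neq0.
have /(lift_inj la0) e : lift la false y = lift la false (act (glue false) x).
  by apply: (mulfI z0); rewrite zw zT.
by rewrite -[RHS]to_torusE e to_torusE orb_proj_act//; exact: G_glue.
Qed.

(** A point of the truncated surface outside the core is in the strip between a
    boundary geodesic and the border, and crossing the geodesic glues it to a
    point of the core. *)
Lemma glue_into_core x : trunc_set (pi0 x) -> exists y,
  [/\ core la y, piG y = piG x & piP (into_trunc (pi0 y)) = piP (into_trunc (pi0 x))].
Proof.
move=> tx; have [Dx|] := pselect (core la x); first by exists x.
move=> /existsNP [g /not_implyP [Gg /existsNP [i /contrapT bi]]].
have e0 := eps_gt0 la0; have ew := eps_lt la0; have w0 := collar_width_gt0 la0.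
have ci := (trunc_setP x).1 tx g i Gg.
have Dy : core la (act (glue (~~ i)) (act g x)).
  by apply: core_flip => //; rewrite -/(cot la i _); lra.
have ty := core_trunc_set Dy.
exists (act (glue (~~ i)) (act g x)); split => //.
  by rewrite !orb_proj_act//; [exact: G0_sub_G|exact: G_glue].
have cy : collar la (~~ i) width (act (glue (~~ i)) (act g x)).
  by apply: collar_glue => //; lra.
have cx := beyond_collar la0 bi.
apply/piP_eq/asboolP; case: i bi ci Dy ty cy cx => bi ci Dy ty cy cx.
  apply: rst_sym; apply: rst_step; split; rewrite !into_truncK//.
  by rewrite -(orb_proj_act sG0 x Gg); exists (act g x).
  by exists (act (glue (~~ true)) (act g x)).
  rewrite -(orb_proj_act sG0 x Gg) /= !coordE//.
  have := zw_T tau la0 (act (glue false) (act g x)).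
  by have /= -> := glueK tau la0 false (act g x).
apply: rst_step; split; rewrite !into_truncK//.
  by exists (act (glue (~~ false)) (act g x)).
  by rewrite -(orb_proj_act sG0 x Gg); exists (act g x).
rewrite -(orb_proj_act sG0 x Gg) /= !coordE//.
exact: (zw_T tau la0 (act g x)).
Qed.

(** Representatives in the core that are equivalent under [groupG] are
    equivalent under [groupG0]. *)
Lemma trunc_glued x y : trunc_set (pi0 x) -> trunc_set (pi0 y) -> piG x = piG y ->
  piP (into_trunc (pi0 x)) = piP (into_trunc (pi0 y)).
Proof.
move=> /glue_into_core [x' [Dx xG <-]] /glue_into_core [y' [Dy yG <-]].
rewrite -xG -yG => /(orb_projP sG) [g Gg yE]; rewrite yE in Dy *.
have [k Gk ->] := core_precise la0 Gg Dx Dy.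
by rewrite orb_proj_act.
Qed.

Lemma torus_core (q : torus) : exists x, core la x /\ piG x = q.
Proof.
have [x <-] := orb_proj_surj q; have [g Gg Dx] := core_cover tau la0 x.
by exists (act g x); rewrite orb_proj_act.
Qed.

Definition plumbed_to_torus (q : plumbed) : torus := to_torus (set_val (repr q)).

Definition torus_to_plumbed (q : torus) : plumbed :=
  piP (into_trunc (pi0 (projT1 (cid (torus_core q))))).

Lemma plumbed_to_torusE u : plumbed_to_torus (piP u) = to_torus (set_val u).
Proof. by apply: glued_to_torus; apply/piP_eq; exact: reprK. Qed.

Lemma torus_to_plumbedE x : trunc_set (pi0 x) ->
  torus_to_plumbed (piG x) = piP (into_trunc (pi0 x)).
Proof.
move=> tx; rewrite /torus_to_plumbed; case: cid => y /= [Dy yG].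
by apply: trunc_glued => //; exact: core_trunc_set.
Qed.

Lemma plumbed_surj (q : plumbed) : exists u, piP u = q.
Proof. by exists (repr q); exact: reprK. Qed.

Lemma plumbed_to_torusK : cancel plumbed_to_torus torus_to_plumbed.
Proof.
move=> q; have [u <-] := plumbed_surj q; have [x tx ->] := trunc_lift u.
by rewrite plumbed_to_torusE into_truncK// to_torusE torus_to_plumbedE.
Qed.

Lemma torus_to_plumbedK : cancel torus_to_plumbed plumbed_to_torus.
Proof.
move=> q; have [x [Dx <-]] := torus_core q.
have tx := core_trunc_set Dx.
by rewrite torus_to_plumbedE// plumbed_to_torusE into_truncK// to_torusE.
Qed.

Lemma continuous_plumbed_to_torus : continuous plumbed_to_torus.
Proof.
apply: (@quotient_continuous trunc {eq_quot (glued_equiv P)} torus plumbed_to_torus).2.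
rewrite (_ : _ \o _ = to_torus \o set_val); last by apply: funext => u; exact: plumbed_to_torusE.
move=> u; apply: continuous_comp; first exact: initial_continuous.
exact: continuous_to_torus.
Qed.

Lemma near_trunc_open x : trunc_open (pi0 x) -> \forall y \near x, trunc_open (pi0 y).
Proof.
by move=> tx; apply: continuous_orb_proj; apply: open_nbhs_nbhs; split => //; exact: open_trunc_open.
Qed.

Lemma trunc_open_set p : trunc_open p -> trunc_set p.
Proof. by move=> /trunc_open_sub/interior_subset. Qed.

Lemma continuous_torus_to_plumbed : continuous torus_to_plumbed.
Proof.
move=> q; have [x [Dx <-]] := torus_core q.
apply: (continuous_at_orb_proj sG).
apply: (@continuous_near_eq _ _ (piP \o (into_trunc \o pi0))).
  apply: filterS (near_trunc_open (core_trunc Dx)) => y ty /=.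
  by rewrite torus_to_plumbedE//; exact: trunc_open_set.
apply: continuous_comp; last exact: (@pi_continuous trunc {eq_quot (glued_equiv P)}).
apply: continuous_into_subtype; apply: (@continuous_near_eq _ _ pi0); last exact: continuous_orb_proj.
apply: filterS (near_trunc_open (core_trunc Dx)) => y ty /=.
by rewrite into_truncK//; exact: trunc_open_set.
Qed.

Lemma plumbed_to_torus_holomorphic : holomorphic_on setT plumbed_to_torus.
Proof.
split; first by apply: continuous_subspaceT; exact: continuous_plumbed_to_torus.
move=> V k /holo_orbit [oV dk].
have ck x : V (piG x) -> {for piG x, continuous k}.
  move=> Vx; apply: (continuous_at_orb_proj sG).
  rewrite (_ : k \o piG = ((k \o piG) \o hof) \o @hval R); last first.
    by apply: funext => y /=; rewrite hvalK.
  apply: continuous_comp; first exact: continuous_hval.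
  exact/differentiable_continuous/derivable1_diffP/dk.
have oP : open (setT `&` plumbed_to_torus @^-1` V).
  by rewrite setTI; apply: open_comp => // q _; exact: continuous_plumbed_to_torus.
have oU : open (to_torus @^-1` V).
  by apply: open_comp => // p _; exact: continuous_to_torus.
split.
- exact: oP.
- apply: continuous_in_subspaceT => u; rewrite inE => -[_ Vu].
  rewrite /preimage /= plumbed_to_torusE in Vu.
  rewrite (_ : _ \o piP = k \o (to_torus \o set_val)); last first.
    by apply: funext => v /=; rewrite plumbed_to_torusE.
  apply: continuous_comp.
    apply: continuous_comp; [exact: initial_continuous|exact: continuous_to_torus].
  by have [x xu] := orb_proj_surj (to_torus (set_val u)); move: Vu => /=; rewrite -xu; exact: ck.
exists (k \o to_torus).
  apply/holo_orbit; split.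
    rewrite (_ : _ `&` _ = trunc_set° `&` to_torus @^-1` V).
      by apply: openI => //; exact: open_interior.
    apply/seteqP; split => [_ [[u [_ Vu] <-] iu]|p [ip Vp]].
      by split => //; move: Vu; rewrite /preimage /= plumbed_to_torusE.
    split => //; exists (into_trunc p); last by rewrite into_truncK//; exact: interior_subset.
    by split => //; rewrite /preimage /= plumbed_to_torusE into_truncK//; exact: interior_subset.
  move=> x [[u [_ Vu] ux] _].
  rewrite (_ : (k \o to_torus) \o orb_proj G0 = k \o piG); last first.
    by apply: funext => y /=; rewrite to_torusE.
  by apply: dk; move: Vu; rewrite /preimage /= plumbed_to_torusE ux to_torusE.
by move=> u _ _ /=; rewrite plumbed_to_torusE.
Qed.

(** Every orbit meets the core, which projects to the interior of the truncated
    surface. Hence near each point the map lifts to an element of [groupG] that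
    brings this point into the core. *)
Lemma torus_to_plumbed_holomorphic : holomorphic_on setT torus_to_plumbed.
Proof.
split; first by apply: continuous_subspaceT; exact: continuous_torus_to_plumbed.
move=> V k [oV _ [K hK Kk]]; have [oW dK] := (holo_orbit _ _).1 hK.
apply/holo_orbit; split.
  by rewrite setTI; apply: open_comp => // q _; exact: continuous_torus_to_plumbed.
move=> x [_ Vx]; have [g Gg Dx] := core_cover tau la0 x.
have g0 := special_gt0 sG Gg.
have near_x : \forall y \near x, trunc_open (pi0 (act g y)) /\ V (torus_to_plumbed (piG y)).
  apply: filterI.
    exact: (nbhs_act g0 (near_trunc_open (core_trunc Dx))).
  have cx : {for x, continuous (torus_to_plumbed \o piG)}.
    by apply: continuous_comp; [exact: continuous_orb_proj|exact: continuous_torus_to_plumbed].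
  change (nbhs x ((torus_to_plumbed \o piG) @^-1` V)); apply: cx.
  exact: (@open_nbhs_nbhs plumbed _ _ (conj oV Vx)).
have chart_at y : trunc_open (pi0 (act g y)) ->
    torus_to_plumbed (piG y) = piP (into_trunc (pi0 (act g y))).
  move=> ty; rewrite -(orb_proj_act sG y Gg).
  by apply: torus_to_plumbedE; exact: trunc_open_set.
have W y : trunc_open (pi0 (act g y)) -> V (torus_to_plumbed (piG y)) ->
   (piP @^-1` V) (into_trunc (pi0 (act g y))) /\
   trunc_set° (set_val (into_trunc (pi0 (act g y)))).
  move=> ty Vy; split; first by rewrite /preimage /= -chart_at.
  by rewrite into_truncK; [exact: trunc_open_sub|exact: trunc_open_set].
apply: (@derivable_near _ (((K \o pi0) \o act g) \o hof)).
  apply: filterS (nbhs_hval near_x) => z [tz Vz] /=.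
  have [Wz iz] := W _ tz Vz.
  by rewrite chart_at// -[RHS](Kk _ Wz iz) into_truncK//; exact: trunc_open_set.
apply: derivable_act => //; apply: dK.
have [tx Vx'] := nbhs_singleton near_x; have [Wx ix] := W _ tx Vx'.
have e := into_truncK (trunc_open_set tx).
by split; [exists (into_trunc (pi0 (act g x)))|rewrite -e].
Qed.

Lemma plumbed_biholomorphic : biholomorphic (plumbed_surface P) (punctured_torus la tau).
Proof.
exists plumbed_to_torus, torus_to_plumbed; split.
- exact: plumbed_to_torusK.
- exact: torus_to_plumbedK.
- exact: plumbed_to_torus_holomorphic.
exact: torus_to_plumbed_holomorphic.
Qed.

End Biholomorphism.

Theorem proposition3p2 (R : realType) (lambda tau : R) (lambda_gt0 : 0 < lambda) :
  exists t : R[i],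
    `|t| = (expR (- (pi ^+ 2 / lambda)))%:C /\
    exists P : plumbing lambda t,
      biholomorphic (plumbed_surface P) (punctured_torus lambda tau).
Proof.
exists (plumbing_parameter lambda tau); split; first exact: norm_plumbing_parameter.
exists (collar_plumbing tau lambda_gt0); exact: plumbed_biholomorphic.
Qed.
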